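(* Let $\xi$ be a Lévy process as in the context, started from $\xi_0=0$, with $a=-\mathbf{E}[\xi_1]>0$. Suppose there exist a constant $\alpha>1$ and a function $\ell$ slowly varying at $\infty$ such that $\mathbf{P}\{\xi_1>x\}\sim x^{-\alpha}\ell(x)$ as $x\to\infty$, and that for any $\delta>0$, as $x\to\infty$, $\mathbf{P}\{\xi_1\in(x,x+\delta]\}=\frac{\alpha}{x}\mathbf{P}\{\xi_1>x\}\cdot[\delta+o(1)]$. Then for any $\lambda>0$, as $t\to\infty$, $$\mathbf{E}\big[e^{-\lambda\xi_t};\xi_t\ge0\big]\sim\frac{\alpha}{a\lambda}\cdot\mathbf{P}\{\xi_1>at\}\quad\text{and}\quad\mathbf{E}\big[e^{\lambda\xi_t};\xi_t\le0\big]\sim\frac{\alpha}{a\lambda}\cdot\mathbf{P}\{\xi_1>at\}.$$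
   Context: $\xi=\{\xi_t:t\ge0\}$ is a one-dimensional Lévy process with characteristic exponent $\Phi(\lambda):=-\log\mathbf{E}[e^{i\lambda\xi_1}]=ia\lambda+\frac12\sigma^2\lambda^2+\int_{\mathbb{R}}(1-e^{i\lambda u}+i\lambda u)\,\nu(du)$, where $a\in\mathbb{R}$, $\sigma\ge0$ and $\nu$ is a Lévy measure with $\int_{\mathbb{R}}(|u|\wedge u^2)\,\nu(du)<\infty$; hence $a=-\mathbf{E}[\xi_1]$. $\mathbf{P},\mathbf{E}$ denote the law and expectation of $\xi$ started from $0$. $\mathbf{E}[Y;A]:=\mathbf{E}[Y\mathbf{1}_A]$. $f\sim g$ means $f/g\to1$. *)

(* Defs.v *)
From HB Require Import structures.
From mathcomp Require Import all_boot all_order all_algebra.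
From mathcomp Require Import complex.
From mathcomp Require Import all_classical all_reals all_analysis.

Set Implicit Arguments.
Unset Strict Implicit.
Unset Printing Implicit Defensive.

Import Order.TTheory GRing.Theory Num.Theory.
Import numFieldNormedType.Exports.

Local Open Scope classical_set_scope.
Local Open Scope ring_scope.

Definition asymp_equiv (R : realType) (f g : R -> R) : Prop :=
  f x / g x @[x --> +oo] --> (1 : R).

(* In the sense of Bingham, Goldie and Teugels: positive and measurable on some
   half-line [X, +oo[; the values of [l] before X are irrelevant. *)
Definition slowly_varying (R : realType) (l : R -> R) : Prop :=
  (exists X : R, measurable_fun `[X, +oo[ l /\ forall x, X <= x -> 0 < l x) /\
  (forall c : R, 0 < c -> l (c * x) / l x @[x --> +oo] --> (1 : R)).

Definition cexp (R : realType) (z : R[i]) : R[i] :=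
  Complex (expR (complex.Re z) * cos (complex.Im z))
          (expR (complex.Re z) * sin (complex.Im z)).

Definition cintegral (d : measure_display) (T : measurableType d)
    (R : realType) (mu : {measure set T -> \bar R}) (f : T -> R[i]) : R[i] :=
  Complex (\int[mu]_x complex.Re (f x)) (\int[mu]_x complex.Im (f x)).

Section process.
Context (d : measure_display) (T : measurableType d) (R : realType).
Variable P : probability T R.

(* The product rule for subfamilies is the case where some [B i] are [setT]. *)
Definition mutually_independent (n : nat) (X : 'I_n -> T -> R) : Prop :=
  forall B : 'I_n -> set R, (forall i, measurable (B i)) ->
  P (\bigcap_i (X i @^-1` B i)) = (\prod_(i < n) P (X i @^-1` B i))%E.

(* The time set is [0, +oo[: no condition bears on [xi t] for t < 0. *)
Record levy_process (xi : R -> {RV P >-> R}) : Prop := LevyProcess {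
  levy_start : \forall w \ae P, xi 0 w = 0 ;
  levy_independent_increments : forall (n : nat) (t : nat -> R),
    0 <= t 0%N -> {homo t : i j / (i <= j)%N >-> i <= j} ->
    mutually_independent (fun (i : 'I_n) w => xi (t i.+1) w - xi (t i) w) ;
  levy_stationary_increments : forall s t : R, 0 <= s -> 0 <= t ->
    forall B : set R, measurable B ->
    P ((fun w => xi (s + t) w - xi s w) @^-1` B) = P (xi t @^-1` B) ;
  levy_cadlag : \forall w \ae P,
    (forall t : R, 0 <= t -> xi s w @[s --> t^'+] --> xi t w) /\
    (forall t : R, 0 < t -> cvg (xi s w @[s --> t^'-])) }.

(* E[Y; A] *)
Definition expectation_on (Y : T -> R) (A : set T) : R :=
  fine 'E_P[fun w => (Y w * \1_A w)%R]%E.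

Definition prob (A : set T) : R := fine (P A).

End process.

Section exponent.
Variable R : realType.

Definition levy_measure (nu : {measure set R -> \bar R}) : Prop :=
  nu [set 0] = 0%E /\ (\int[nu]_u (Num.min 1 (u ^+ 2))%:E < +oo)%E.

Local Open Scope complex_scope.

Definition char_exponent (a sigma : R) (nu : {measure set R -> \bar R})
    (lambda : R) : R[i] :=
  (a * lambda)*i + (2^-1 * sigma ^+ 2 * lambda ^+ 2)%:C +
  cintegral nu (fun u : R => 1 - cexp (lambda * u)*i + (lambda * u)*i).

(* The relation Phi = - log E[exp(i lambda X)] in exponentiated form: as Phi is
   continuous with Phi 0 = 0, the logarithm meant is the continuous branch that
   vanishes at 0. *)
Definition has_char_exponent (d : measure_display) (T : measurableType d)
    (P : probability T R) (X : {RV P >-> R}) (Phi : R -> R[i]) : Prop :=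
  forall lambda : R,
    cintegral P (fun w => cexp (lambda * X w)*i) = cexp (- Phi lambda).

End exponent.

(* Main.v *)
Require Import Defs.
From HB Require Import structures.
From mathcomp Require Import all_boot all_order all_algebra.
From mathcomp Require Import all_classical all_reals all_analysis.
From mathcomp Require Import measurable_realfun.
From mathcomp Require Import ring lra.

Import Order.TTheory GRing.Theory Num.Theory.
Import numFieldNormedType.Exports.

Local Open Scope classical_set_scope.
Local Open Scope ring_scope.

(** One big jump.  Write [P_t f x = E f(x + xi_t)], a convolution semigroup, and
    split the unit-step operator as [P_1 = A + B] according to whether the
    increment is below or above [eps * t].  All these operators commute, so with
    [t = n + r], [0 <= r < 1],
      [P_1^n <= A^n + n P_1^(n-1) B],
      [n P_1^(n-1) B <= P_1^n + n (n-1) P_1^(n-2) B^2],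
    and everything reduces to one-dimensional estimates for
    [g x = exp(-lambda b x) 1(b x >= 0)], [b = 1] or [b = -1]:
    - [A^n g] is smaller than any given power of [t], by Chernoff's bound at
      [s = kap * ln t / t] with [eps] small;
    - by the weak law of large numbers [xi_(t-1)] is near [-a t], where [B g] is
      close to [G(a t)], [G y = E g(xi_1 - y)]; elsewhere [B g] is at most of
      order [q(eps t)], where [q y = alpha / y * P(xi_1 > y)];
    - [G y ~ q y / lambda]: [G] solves [G y = exp(-lambda dl) G(y + b dl) + error],
      the error lying between [exp(-lambda dl)] and [1] times the probability of
      an interval of length [dl] at [y], itself equivalent to [dl * q y].
    Hence [E g(xi_t) ~ t q(a t) / lambda].  The fractional time [r] is harmless:
    stochastic continuity bounds [P(|xi_(1-r)| <= N)] below uniformly in [r], so a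
    jump of [xi_r] costs at most a constant times a jump of [xi_1]. *)

(** * Convolution operators *)

(** The local hypothesis holds for each fixed [delta], with no uniformity in [delta], so [G] is not
    obtained from ever finer Riemann sums. Its recursion uses one cell length [dl]: it is a
    contraction that brings [G / q] within a multiple of [dl] of [1 / lambda], and [dl] is chosen
    small beforehand, as a function of the target error. Only a first moment is available in
    general, so exponential moments need a truncation. With [s = kap * ln t / t] the drift yields a
    factor [t ^ (- a * kap / 4)] over [t / 2] steps, while jumps up to [eps * t] inflate
    exponentials by [t ^ (kap * eps)]. The jumps between [1 / s] and [eps * t] remain harmless
    because [P(xi_1 > 1 / s) <= s ^ beta] with [1 < beta < alpha], as long as [kap * eps] is small
    compared with [beta - 1]. Hence [kap] may be large if [eps] is small, and the decay beats
    [q(a t)], which is at least of order [t ^ (- alpha - 2)]. Since [beta > 1] also gives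
    [t * P(xi_1 > eps t) -> 0], pairs of big jumps are negligible. *)

Section convolution.
Context {R : realType}.
Local Open Scope ereal_scope.
Implicit Types (mu nu : probability R R) (D E : set R) (f g : R -> \bar R).

(** Values in [\bar R] let Tonelli's theorem and monotonicity apply to nonnegative functions without
    integrability conditions. The sets [D] and its complement give the operators [A] and [B]. *)
Definition conv mu D f (x : R) : \bar R := \int[mu]_(u in D) f (x + u)%R.

Definition nnm f := measurable_fun setT f /\ forall x, 0 <= f x.

Lemma nnm_shift f (x : R) : nnm f -> measurable_fun setT (fun u : R => f (x + u)%R).
Proof. by case=> mf _; apply: (measurableT_comp mf); exact: measurable_funD. Qed.

Lemma nnm_cst (c : \bar R) : 0 <= c -> nnm (cst c).
Proof. by move=> c0; split => //; exact: measurable_cst. Qed.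

Lemma nnmD f g : nnm f -> nnm g -> nnm (f \+ g).
Proof.
move=> [mf f0] [mg g0]; split; first exact: emeasurable_funD.
by move=> x; rewrite adde_ge0.
Qed.

Lemma nnmZ f (k : R) : (0 <= k)%R -> nnm f -> nnm (fun x => k%:E * f x).
Proof.
move=> k0 [mf f0]; split; first exact: measurable_funeM.
by move=> x; rewrite mule_ge0.
Qed.

Lemma conv_mkcond mu D f x : conv mu D f x = \int[mu]_u (f (x + u)%R * (\1_D u)%:E).
Proof. by rewrite /conv integral_mkcond; under [LHS]eq_integral do rewrite epatch_indic. Qed.

Lemma conv_ge0 mu D f x : (forall x, 0 <= f x) -> 0 <= conv mu D f x.
Proof. by move=> f0; exact: integral_ge0. Qed.

Lemma nnm_conv mu D f : measurable D -> nnm f -> nnm (conv mu D f).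
Proof.
move=> mD [mf f0]; split; last by move=> x; exact: conv_ge0.
pose F (z : R * R) := f (z.1 + z.2)%R * (\1_D z.2)%:E.
rewrite (_ : conv mu D f = fubini_F mu F); last first.
  by apply/funext => x; rewrite conv_mkcond.
apply: measurable_fun_fubini_tonelli_F.
- apply: emeasurable_funM.
  + by apply: (measurableT_comp mf); exact: measurable_funD.
  + by apply/measurable_EFinP; apply: measurableT_comp => //; exact: measurable_indic.
- by move=> z; rewrite mule_ge0// lee_fin.
Qed.

Lemma le_conv mu D f g x : measurable D -> nnm f -> nnm g ->
  (forall u, D u -> f (x + u)%R <= g (x + u)%R) -> conv mu D f x <= conv mu D g x.
Proof.
move=> mD nf ng fg; apply: ge0_le_integral => //.
- by move=> u _; exact: nf.2.
- exact: (measurable_funS _ _ (nnm_shift f x nf)).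
- exact: (measurable_funS _ _ (nnm_shift g x ng)).
Qed.

Lemma convD mu D f g x : measurable D -> nnm f -> nnm g ->
  conv mu D (f \+ g) x = conv mu D f x + conv mu D g x.
Proof.
move=> mD nf ng; rewrite /conv ge0_integralD//.
- by move=> u _; exact: nf.2.
- exact: (measurable_funS _ _ (nnm_shift f x nf)).
- by move=> u _; exact: ng.2.
- exact: (measurable_funS _ _ (nnm_shift g x ng)).
Qed.

Lemma convZ mu D f (k : R) x : measurable D -> (0 <= k)%R -> nnm f ->
  conv mu D (fun y => k%:E * f y) x = k%:E * conv mu D f x.
Proof.
move=> mD k0 nf; rewrite /conv ge0_integralZl//.
- exact: (measurable_funS _ _ (nnm_shift f x nf)).
- by move=> u _; exact: nf.2.
Qed.

Lemma conv_cst mu D (k : R) x : measurable D -> conv mu D (cst k%:E) x = k%:E * mu D.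
Proof. by move=> mD; rewrite /conv integral_cst. Qed.

Lemma conv_cst_le mu D (k : R) x : measurable D -> (0 <= k)%R ->
  conv mu D (cst k%:E) x <= k%:E.
Proof.
move=> mD k0; rewrite conv_cst// -[leRHS]mule1 lee_wpmul2l ?lee_fin//.
exact: probability_le1.
Qed.

Lemma conv_setC mu D f x : measurable D -> nnm f ->
  conv mu setT f x = conv mu D f x + conv mu (~` D) f x.
Proof.
move=> mD nf; rewrite /conv -[in LHS](setUv D) ge0_integral_setU//.
- exact: measurableC.
- by rewrite setUv; exact: nnm_shift.
- by move=> u _; exact: nf.2.
- by rewrite disj_set2E setICr.
Qed.

(** Translations commute: by Tonelli both sides are the double integral of [f (x + u + v)]. *)
Lemma conv_comm mu nu D E f x : measurable D -> measurable E -> nnm f ->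
  conv mu D (conv nu E f) x = conv nu E (conv mu D f) x.
Proof.
move=> mD mE [mf f0].
pose F (z : R * R) := f (x + z.1 + z.2)%R * (\1_D z.1)%:E * (\1_E z.2)%:E.
have mF : measurable_fun setT F.
  apply: emeasurable_funM; first apply: emeasurable_funM.
  + apply: (measurableT_comp mf); apply: measurable_funD => //.
    exact: measurable_funD.
  + by apply/measurable_EFinP; apply: measurableT_comp => //; exact: measurable_indic.
  + by apply/measurable_EFinP; apply: measurableT_comp => //; exact: measurable_indic.
have F0 z : 0 <= F z by rewrite !mule_ge0// lee_fin.
have mfx (y : R) : measurable_fun setT (fun v : R => f (y + v)%R * (\1_E v)%:E).
  apply: emeasurable_funM; first exact: nnm_shift.
  by apply/measurable_EFinP; exact: measurable_indic.
have mfx' (y : R) : measurable_fun setT (fun v : R => f (y + v)%R * (\1_D v)%:E).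
  apply: emeasurable_funM; first exact: nnm_shift.
  by apply/measurable_EFinP; exact: measurable_indic.
transitivity (\int[mu]_u \int[nu]_v F (u, v)).
  rewrite conv_mkcond; apply: eq_integral => u _.
  rewrite conv_mkcond muleC -ge0_integralZl//; last first.
    by move=> v _; rewrite mule_ge0// lee_fin.
  by apply: eq_integral => v _; rewrite /F/= muleCA muleA.
rewrite fubini_tonelli// conv_mkcond; apply: eq_integral => v _.
rewrite conv_mkcond muleC -ge0_integralZl//; last first.
  by move=> u _; rewrite mule_ge0// lee_fin.
by apply: eq_integral => u _; rewrite /F/= [RHS]muleC addrAC.
Qed.

Lemma nnm_iter mu D f n : measurable D -> nnm f -> nnm (iter n (conv mu D) f).
Proof. by move=> mD nf; elim: n => //= n ih; exact: nnm_conv. Qed.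

Lemma le_iter_conv mu D f g n x : measurable D -> nnm f -> nnm g ->
  (forall y, f y <= g y) -> iter n (conv mu D) f x <= iter n (conv mu D) g x.
Proof.
move=> mD nf ng fg; elim: n x => [//|n ih] x /=.
by apply: le_conv => //; exact: nnm_iter.
Qed.

Lemma iter_convD mu D f g n x : measurable D -> nnm f -> nnm g ->
  iter n (conv mu D) (f \+ g) x = iter n (conv mu D) f x + iter n (conv mu D) g x.
Proof.
move=> mD nf ng; elim: n x => [//|n ih] x /=.
rewrite -convD//; [|exact: nnm_iter..].
by congr conv; apply/funext => y; exact: ih.
Qed.

Lemma iter_convZ mu D f (k : R) n x : measurable D -> (0 <= k)%R -> nnm f ->
  iter n (conv mu D) (fun y => k%:E * f y) x = k%:E * iter n (conv mu D) f x.
Proof.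
move=> mD k0 nf; elim: n x => [//|n ih] x /=.
rewrite -convZ//; [|exact: nnm_iter..].
by congr conv; apply/funext => y; exact: ih.
Qed.

Lemma iter_conv_cst mu D (k : R) n x : measurable D -> (0 <= k)%R ->
  iter n (conv mu D) (cst k%:E) x <= k%:E.
Proof.
move=> mD k0; elim: n x => [//|n ih] x /=.
apply: le_trans (conv_cst_le mu D k x mD k0); apply: le_conv => //.
by apply: nnm_iter => //; exact: nnm_cst.
Qed.

Lemma iter_conv_comm mu nu D E f n x : measurable D -> measurable E -> nnm f ->
  conv nu E (iter n (conv mu D) f) x = iter n (conv mu D) (conv nu E f) x.
Proof.
move=> mD mE nf; elim: n x => [//|n ih] x /=.
rewrite conv_comm//; last exact: nnm_iter.
by congr conv; apply/funext => y; exact: ih.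
Qed.

(* Union bound over the jump that falls outside [D]. *)
Lemma iter_conv_le mu D f n x : measurable D -> nnm f ->
  iter n.+1 (conv mu setT) f x <= iter n.+1 (conv mu D) f x +
    n.+1%:R%:E * iter n (conv mu setT) (conv mu (~` D) f) x.
Proof.
move=> mD nf; have mC : measurable (~` D) by exact: measurableC.
have nB : nnm (conv mu (~` D) f) by exact: nnm_conv.
elim: n x => [|n ih] x; first by rewrite /= mul1e -conv_setC.
(* The outermost step is split. Its part outside [D] is commuted to the innermost place, where it is
   the new term of the union bound; its part inside [D] is left to the induction. *)
rewrite [in leLHS]iterS (conv_setC _ D)//; last exact: nnm_iter.
rewrite [X in _ + X <= _]iter_conv_comm//.
apply: (@le_trans _ _ (iter n.+2 (conv mu D) f x +
    n.+1%:R%:E * iter n.+1 (conv mu setT) (conv mu (~` D) f) x +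
    iter n.+1 (conv mu setT) (conv mu (~` D) f) x)); last first.
  rewrite -addeA leeD2l// -[X in _ + X <= _]mul1e -ge0_muleDl ?lee_fin//.
  by rewrite -EFinD natr1.
rewrite leeD2r//.
have nA : nnm (fun y => n.+1%:R%:E * iter n (conv mu setT) (conv mu (~` D) f) y).
  by apply: nnmZ => //; exact: nnm_iter.
apply: (@le_trans _ _ (conv mu D (iter n.+1 (conv mu D) f \+
    (fun y => n.+1%:R%:E * iter n (conv mu setT) (conv mu (~` D) f) y)) x)).
  apply: le_conv => //; first exact: nnm_iter.
  by apply: nnmD => //; exact: nnm_iter.
rewrite convD//; last exact: nnm_iter.
rewrite convZ//; last exact: nnm_iter.
rewrite -iterS leeD2l// lee_wpmul2l ?lee_fin// [in leRHS]iterS.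
rewrite (conv_setC _ D)//; last exact: nnm_iter.
by rewrite leeDl// conv_ge0//; exact: (nnm_iter _ _ _ _ _ _).2.
Qed.

(** The [n.+1] events that one prescribed step alone falls outside [D] are disjoint, and by
    commutation they all contribute the same amount. *)
Lemma iter_conv_ge mu D f n x : measurable D -> nnm f ->
  n.+1%:R%:E * iter n (conv mu D) (conv mu (~` D) f) x <= iter n.+1 (conv mu setT) f x.
Proof.
move=> mD nf; have mC : measurable (~` D) by exact: measurableC.
have nB : nnm (conv mu (~` D) f) by exact: nnm_conv.
elim: n x => [|n ih] x.
  by rewrite /= mul1e (conv_setC _ D)// leeDr// conv_ge0//; exact: nf.2.
rewrite [in leRHS]iterS (conv_setC _ D)//; last exact: nnm_iter.
have -> : n.+2%:R%:E = n.+1%:R%:E + 1 :> \bar R by rewrite -EFinD -natr1.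
rewrite ge0_muleDl ?lee_fin// mul1e leeD//.
- rewrite iterS -convZ//; last exact: nnm_iter.
  apply: le_conv => //; last exact: nnm_iter.
  by apply: nnmZ => //; exact: nnm_iter.
- rewrite iter_conv_comm//.
  elim: n.+1 x {ih} => [//|m ih] x /=.
  apply: (@le_trans _ _ (conv mu D (iter m (conv mu setT) (conv mu (~` D) f)) x)).
    by apply: le_conv => //; exact: nnm_iter.
  rewrite (conv_setC mu D _ x mD); last exact: nnm_iter.
  by rewrite leeDl// conv_ge0//; exact: (nnm_iter _ _ _ _ _ _).2.
Qed.

(* Bonferroni's inequality of order two for the jumps outside [D]. *)
Lemma iter_conv_bonferroni mu D f n x : measurable D -> nnm f ->
  n.+2%:R%:E * iter n.+1 (conv mu setT) (conv mu (~` D) f) x <=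
  iter n.+2 (conv mu setT) f x + (n.+2%:R * n.+1%:R)%:E *
    iter n (conv mu setT) (conv mu (~` D) (conv mu (~` D) f)) x.
Proof.
move=> mD nf; have mC : measurable (~` D) by exact: measurableC.
have nB : nnm (conv mu (~` D) f) by exact: nnm_conv.
have nBB : nnm (conv mu (~` D) (conv mu (~` D) f)) by exact: nnm_conv.
apply: (@le_trans _ _ (n.+2%:R%:E * (iter n.+1 (conv mu D) (conv mu (~` D) f) x +
    n.+1%:R%:E * iter n (conv mu setT) (conv mu (~` D) (conv mu (~` D) f)) x))).
  by rewrite lee_wpmul2l ?lee_fin//; exact: iter_conv_le.
rewrite ge0_muleDr; last 2 first.
  exact: (nnm_iter _ _ _ _ _ _).2.
  by rewrite mule_ge0 ?lee_fin//; exact: (nnm_iter _ _ _ _ _ _).2.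
by rewrite EFinM muleA leeD2r//; exact: iter_conv_ge.
Qed.

End convolution.

(** * The semigroup of a Levy process *)

Section levy_semigroup.
Context {d : measure_display} {T : measurableType d} {R : realType}.
Context {P : probability T R} {xi : R -> {RV P >-> R}}.
Hypothesis xi_levy : levy_process xi.
Local Open Scope ereal_scope.

Definition law (t : R) : probability R R := distribution P (xi t).

Let incr (s t : R) : {RV P >-> R} := (xi t \- xi s)%R.

Lemma law_incr (s t : R) : (0 <= s)%R -> (0 <= t)%R ->
  forall B, measurable B -> distribution P (incr s (s + t)%R) B = law t B.
Proof. by move=> s0 t0 B mB; exact: (levy_stationary_increments xi_levy). Qed.

(** The increments over [[0, s]] and [[s, s + t]] are independent, so their joint law agrees with
    the product of [law s] and [law t] on rectangles, hence everywhere. *)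
Lemma conv_lawD (s t : R) f x : (0 <= s)%R -> (0 <= t)%R -> nnm f ->
  conv (law (s + t)%R) setT f x = conv (law s) setT (conv (law t) setT f) x.
Proof.
move=> s0 t0 nf; have st0 : (0 <= s + t)%R by exact: addr_ge0.
pose X w := (incr 0%R s w, incr s (s + t)%R w).
have mX : measurable_fun setT X.
  by apply/measurable_fun_pairP; split; exact: measurable_funP.
pose XX : {mfun T >-> (R * R)%type} := mfun_Sub (mem_set mX).
have joint A B : measurable A -> measurable B ->
    pushforward P XX (A `*` B) = law s A * law t B.
  move=> mA mB.
  pose tt (i : nat) : R := if i is i'.+1 then if i' is 0%N then s else (s + t)%R else 0%R.
  have htt : {homo tt : i j / (i <= j)%N >-> (i <= j)%R}.
    by move=> [|[|i]] [|[|j]]//= _; rewrite ?lerDl.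
  pose BB (i : 'I_2) : set R := if val i is 0%N then A else B.
  transitivity (P (\bigcap_(i in [set: 'I_2])
      ((fun w => xi (tt i.+1) w - xi (tt i) w)%R @^-1` BB i))).
    congr (P _); apply/seteqP; split => [w [/= Aw Bw] [[|[|//]] i] _ //|w h].
    by split; [exact: (h ord0 I)|exact: (h (lift ord0 ord0) I)].
  rewrite (levy_independent_increments xi_levy (n := 2) (t := tt) (lexx _) htt (B := BB)).
    rewrite big_ord_recl big_ord1 /BB/=.
    by rewrite -(law_incr 0%R s)// add0r -(law_incr s t).
  by rewrite /BB; case=> [[|i]].
pose F (z : R * R) := f (x + z.1 + z.2)%R.
have mF : measurable_fun setT F.
  apply: (measurableT_comp nf.1); apply: measurable_funD => //.
  exact: measurable_funD.
have F0 z : 0 <= F z by exact: nf.2.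
(* [xi (s + t)] is replaced by [xi (s + t) - xi 0], which has the same law by stationarity:
   increments telescope at every point, whereas [xi 0 = 0] holds only almost surely. *)
transitivity (\int[P]_w f (x + incr 0%R (s + t)%R w)%R).
  have nfx := nnm_shift f x nf.
  rewrite -(@ge0_integral_distribution _ _ _ _ _ P (incr 0%R (s + t)%R) (fun u : R => f (x + u)%R))//; last first.
    by move=> u; exact: nf.2.
  apply: eq_measure_integral => B mB _.
  by have := law_incr 0%R (s + t)%R (lexx _) st0 B mB; rewrite add0r => h; exact/esym/h.
transitivity (\int[(law s \x law t)%E]_z F z); last exact: fubini_tonelli1.
transitivity (\int[pushforward P XX]_z F z); last first.
  apply: eq_measure_integral => B mB _; apply/esym.
  by apply: product_measure_unique => // A C mA mC; exact: joint.
rewrite ge0_integral_pushforward//; apply: eq_integral => w _.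
by rewrite /F/=; congr f; ring.
Qed.

Lemma le_indic (A B : set R) x y : (A x -> B y) -> (\1_A x <= \1_B y :> R)%R.
Proof.
move=> AB; rewrite !indicE; have [xA|//] := boolP (x \in A).
by rewrite (mem_set (AB (set_mem xA))).
Qed.

Lemma conv_indic (mu : probability R R) A : measurable A ->
  conv mu setT (fun x => (\1_A x)%:E) 0%R = mu A.
Proof.
by move=> mA; rewrite /conv; under eq_integral do rewrite add0r; rewrite integral_indic// setIT.
Qed.

Lemma nnm_indic (A : set R) : measurable A -> nnm (fun x => (\1_A x)%:E).
Proof. by move=> mA; split => [|x]; [exact/measurable_EFinP/measurable_indic|rewrite lee_fin]. Qed.

(** The independent increment of duration [t] is kept only on [D], an event of probability at least
    [p] on which it takes [f] below [f']. This carries estimates from a later time back to an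
    earlier one at the cost of a constant factor. *)
Lemma conv_lawD_ge (s t p : R) D f f' x : (0 <= s)%R -> (0 <= t)%R -> (0 <= p)%R ->
  measurable D -> nnm f -> nnm f' ->
  (forall y u, D u -> f y <= f' (y + u)%R) -> p%:E <= law t D ->
  p%:E * conv (law s) setT f x <= conv (law (s + t)%R) setT f' x.
Proof.
move=> s0 t0 p0 mD nf nf' ff' pD; rewrite conv_lawD// -convZ//.
apply: le_conv => //; [exact: nnmZ|exact: nnm_conv|move=> u _].
move: (x + u)%R => y; rewrite (conv_setC _ D)//.
apply: (@le_trans _ _ (conv (law t) D f' y)); last first.
  by rewrite leeDl// conv_ge0//; exact: nf'.2.
apply: (@le_trans _ _ (\int[law t]_(v in D) (cst (f y) v))).
  by rewrite integral_cst// muleC lee_wpmul2l//; exact: nf.2.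
apply: ge0_le_integral => //.
- by move=> ? _; exact: nf.2.
- exact: (measurable_funS _ _ (nnm_shift f' y nf')).
- by move=> v Dv; exact: ff'.
Qed.

Local Notation cball c := (`[(- c)%R, c%R]%classic : set R).

(** Otherwise there are times [u n > 0] tending to 0 with mass below 1/2 on [[-1, 1]], but
    right-continuity of the paths at 0 and dominated convergence make this mass tend to 1. *)
Lemma law_stochastic_continuity :
  exists2 h : R, (0 < h)%R & forall s : R, (0 <= s <= h)%R -> (2^-1)%:E <= law s (cball 1).
Proof.
apply: contrapT => /forall2NP H.
have {}H n : exists s : R, (0 < s <= n.+1%:R^-1)%R /\ law s (cball 1) < (2^-1)%:E.
  have [/negP|/existsNP[s /not_implyP[/andP[s0 sn] /negP]]] := H n.+1%:R^-1%R.
    by rewrite invr_gt0 ltr0n.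
  rewrite -ltNge => ls; exists s => //; rewrite sn andbT lt_neqAle s0 andbT.
  split => //; apply/eqP => s0'; move: ls; rewrite -s0' -(law_incr 0%R 0%R)//.
  rewrite (_ : distribution P _ _ = 1%:E) ?lte_fin; first by lra.
  rewrite -(probability_setT P); congr (P _); apply/seteqP; split => // w _ /=.
  by rewrite addr0 subrr in_itv/= lerN10 ler01.
have [u hu] := choice H.
have u0 : u n @[n --> \oo] --> (0 : R)%R.
  apply: (@squeeze_cvgr _ _ _ _ (cst 0%R) (fun n => n.+1%:R^-1)%R).
  - by apply: nearW => n; have [/andP[/ltW -> ->]] := hu n.
  - exact: cvg_cst.
  - exact: cvg_harmonic.
have mB : measurable (cball 1) by exact: measurable_itv.
pose F n w : \bar R := (\1_(incr 0%R (u n) @^-1` cball 1) w)%:E.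
have mI n : measurable (incr 0%R (u n) @^-1` cball 1).
  by rewrite -[X in measurable X]setTI; exact: measurable_funP.
have mF n : measurable_fun setT (F n) by exact/measurable_EFinP/measurable_indic.
have F1 : {ae P, forall w, setT w -> F ^~ w @ \oo --> (cst 1 w : \bar R)}.
  apply: filterS (levy_cadlag xi_levy) => w [/(_ 0%R (lexx _)) /cvg_at_rightP cad _] _.
  have {cad} : xi (u n) w @[n --> \oo] --> xi 0%R w.
    by apply: cad; split => // n; have [/andP[]] := hu n.
  move=> /cvgrPdist_le /(_ 1%R ltr01) cvw.
  apply: cvg_near_cst; near=> n.
  rewrite /F/= indicE mem_set//= in_itv/= -ler_norml distrC.
  by near: n.
have iF : P.-integrable setT (cst 1 : T -> \bar R).
  exact: finite_measure_integrable_cst.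
have bF : {ae P, forall w n, setT w -> `|F n w| <= cst 1 w}.
  by apply: aeW => w n _; rewrite /F/= lee_fin ger0_norm// indicE lern1 leq_b1.
have [_ _ cv] := dominated_convergence measurableT mF (measurable_cst _) F1 iF bF.
have {}cv : \int[P]_w F n w @[n --> \oo] --> (1 : \bar R).
  rewrite -(probability_setT P) -[X in _ --> X]mul1e -(@integral_cst _ _ _ _ setT)//.
move/fine_cvgP : cv => [_ /cvgrPdist_lt/(_ 2^-1%R)]; rewrite invr_gt0 ltr0n => /(_ isT)[n _ /(_ n (leqnn n))].
rewrite /= /F integral_indic// setIT.
have [/andP[/ltW un0 _]] := hu n.
have := law_incr 0%R (u n) (lexx _) un0 (cball 1) mB; rewrite add0r => E.
rewrite [X in fine X](_ : _ = law (u n) (cball 1)); last exact: E.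
have pf : law (u n) (cball 1) \is a fin_num by exact: fin_num_measure.
rewrite -[X in X < _]fineK// lte_fin /= => h1.
by rewrite ltr_distl => /andP[]; lra.
Unshelve. all: by end_near. Qed.

(** A time in [[0, 1]] is cut into at most [n.+1] pieces of length at most [h]. The independent
    increments each stay in [[-1, 1]] with probability at least 1/2, which gives [N = n.+1] and
    [p = 2^-1 ^+ n.+1]. *)
Lemma law_cball_ge : exists N p : R, [/\ (0 < N)%R, (0 < p)%R &
  forall r : R, (0 <= r <= 1)%R -> p%:E <= law r (cball N)].
Proof.
have mB c : measurable (cball c) by exact: measurable_itv.
have [h h0 hh] := law_stochastic_continuity.
have H n (s : R) : (0 <= s <= n.+1%:R * h)%R -> (2^-1 ^+ n.+1)%:E <= law s (cball n.+1%:R).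
  elim: n s => [|n ih] s; first by rewrite mul1r expr1; exact: hh.
  move=> /andP[s0 sn]; pose t := Num.min s h; pose r := (s - t)%R.
  have [t0 th] : (0 <= t /\ t <= h)%R by rewrite /t le_min s0 (ltW h0) ge_min lexx orbT.
  have r0 : (0 <= r)%R by rewrite subr_ge0 ge_min lexx.
  have rn : (r <= n.+1%:R * h)%R.
    rewrite /r /t /Num.min; case: ifP => _; first by rewrite subrr mulr_ge0// ltW.
    by move: sn; rewrite lerBlDr -(natr1 n.+1) mulrDl mul1r.
  have -> : s = (r + t)%R by rewrite subrK.
  rewrite -(conv_indic (law (r + t)%R) (cball n.+2%:R))//.
  apply: (@le_trans _ _ ((2^-1)%:E * conv (law r) setT (fun x => (\1_(cball n.+1%:R) x)%:E) 0%R)).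
    by rewrite conv_indic// exprS EFinM lee_wpmul2l ?lee_fin ?invr_ge0//; apply: ih; rewrite r0.
  apply: (conv_lawD_ge _ _ _ (cball 1)) => //; [by apply: nnm_indic..| |by apply: hh; rewrite t0].
  move=> y v /=; rewrite in_itv/= => /andP[v1 v2]; rewrite lee_fin; apply: le_indic => /=.
  by rewrite !in_itv/= -(natr1 n.+1) => /andP[y1 y2]; apply/andP; split; lra.
have [n hn] : exists n, (1 <= n.+1%:R * h)%R.
  exists (Num.truncn h^-1); rewrite -ler_pdivrMr// div1r; apply: ltW; exact: truncnS_gt.
exists n.+1%:R, (2^-1 ^+ n.+1)%R; split; [by rewrite ltr0n|by rewrite exprn_gt0// invr_gt0|].
by move=> r /andP[r0 r1]; apply: H; rewrite r0 (le_trans r1).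
Qed.

Lemma iter_conv_law n (r : R) f x : (0 <= r)%R -> nnm f ->
  iter n (conv (law 1%R) setT) (conv (law r) setT f) x = conv (law (n%:R + r)%R) setT f x.
Proof.
move=> r0 nf; elim: n x => [|n ih] x; first by rewrite add0r.
rewrite -natr1 (addrC n%:R%R) -addrA conv_lawD// ?addr_ge0//=.
by congr conv; apply/funext => y; exact: ih.
Qed.

End levy_semigroup.
Arguments law {d T R P} xi t.

(** * Truncated exponential moments and the weak law of large numbers *)

Section truncated_mgf.
Context {R : realType}.

Lemma expRB1_le (x : R) : x <= expR x - 1 <= x * expR x.
Proof.
have h1 := expR_ge1Dx x; have h2 := expR_ge1Dx (- x).
have h3 : expR x * expR (- x) = 1 by rewrite expRxMexpNx_1.
have h4 : expR x * (1 - x) <= 1 by rewrite -[leRHS]h3 ler_wpM2l ?expR_ge0.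
by apply/andP; split; [lra|move: h4; rewrite mulrBr mulr1 (mulrC _ x); lra].
Qed.

Lemma norm_expRB1_le (x : R) : x <= 1 -> `|expR x - 1| <= expR 1 * `|x|.
Proof.
move=> x1; have /andP[h1 h2] := expRB1_le x.
have e1 : 1 <= expR 1 :> R by rewrite -[leLHS]expR0 ler_expR.
have [x0|x0] := leP 0 x.
  rewrite ger0_norm; last exact: le_trans h1.
  by rewrite ger0_norm// (le_trans h2)// mulrC ler_wpM2r// ler_expR.
have ex1 : expR x <= 1 by rewrite -[leRHS]expR0 ler_expR ltW.
rewrite ler0_norm ?subr_le0// ltr0_norm// (@le_trans _ _ (- x))//; first lra.
by rewrite ler_peMl// oppr_ge0 ltW.
Qed.

Variables (mu : probability R R) (m : R).
Hypothesis mu_int : mu.-integrable setT (EFin : R -> \bar R).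
Hypothesis mu_mean : (\int[mu]_u u%:E = m%:E)%E.

(** The factor [b] is [1] or [-1], for deviations upwards or downwards; the cutoff [z] is on the
    side where the exponential grows. *)
Definition tmgf (b s z : R) : R :=
  \int[mu]_(u in [set u | b * u <= z]) expR (s * (b * u)).

(** Integrand of the difference quotient of [tmgf] at 0, with a cutoff [s^-1] that moves with [s].
    Below the cutoff the exponent is at most 1; above it [psi] is [- s^-1], smaller in modulus than
    [b * u]. So one multiple of the modulus of [b * u] dominates all quotients. *)
Let psi (b s u : R) : R :=
  (expR (s * (b * u)) * \1_[set u | b * u <= s^-1] u - 1) / s.

Lemma measurable_le_set (b z : R) : measurable [set u : R | b * u <= z].
Proof.
rewrite (_ : [set _ | _] = (fun u : R => b * u) @^-1` `]-oo, z]%classic); last first.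
  by apply/seteqP; split => u /=; rewrite in_itv.
rewrite -[X in measurable X]setTI.
have mb : measurable_fun setT (fun u : R => b * u) by exact: measurable_funM.
by apply: mb => //; exact: measurable_itv.
Qed.

Let mpsi b s : measurable_fun setT (psi b s).
Proof.
apply: measurable_funM => //; apply: measurable_funB => //.
apply: measurable_funM; last by apply: measurable_indic; exact: measurable_le_set.
by apply: measurableT_comp => //; do 2 apply: measurable_funM => //.
Qed.

Let psi_le b s u : 0 < s -> `|psi b s u| <= expR 1 * `|b * u|.
Proof.
move=> s0; rewrite /psi indicE normrM normfV (gtr0_norm s0) ler_pdivrMr//.
have [/set_mem/= bu|/negP nbu] := boolP (u \in _).
  rewrite mulr1 -mulrA (mulrC `|_|) -{2}(gtr0_norm s0) -normrM.
  by apply: norm_expRB1_le; rewrite mulrC -ler_pdivlMr// div1r.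
have {nbu} bu : s^-1 < b * u by rewrite ltNge; apply/negP => h; apply: nbu; exact: mem_set.
rewrite mulr0 sub0r normrN1 -mulrA (@le_trans _ _ (`|b * u| * s))//.
  by rewrite -ler_pdivrMr// div1r (le_trans (ltW bu))// ler_norm.
apply: ler_peMl; first by rewrite mulr_ge0// ltW.
by rewrite -[leLHS]expR0 ler_expR.
Qed.

Let psi_cvg b u (s : R^nat) : (forall n, 0 < s n) -> s n @[n --> \oo] --> 0 ->
  psi b (s n) u @[n --> \oo] --> b * u.
Proof.
move=> s0 s_cvg; set c := b * u.
have scvg : expR (s n * c) @[n --> \oo] --> (1 : R).
  rewrite -expR0 -(mul0r c); apply: continuous_cvg; first exact: continuous_expR.
  exact: cvgMr_tmp.
have near1 : \forall n \near \oo, c <= (s n)^-1.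
  have : \forall n \near \oo, s n < (`|c| + 1)^-1.
    by apply: (cvgr_lt 0) => //; rewrite invr_gt0 ltr_wpDl.
  apply: filterS => n sn; rewrite (@le_trans _ _ (`|c| + 1))//.
    by rewrite (le_trans (ler_norm _))// lerDl.
  by rewrite -[leLHS]invrK lef_pV2 ?posrE ?invr_gt0 ?ltr_wpDl// ltW.
apply: (@squeeze_cvgr _ _ _ _ (cst c) (fun n => c * expR (s n * c))).
- apply: filterS near1 => n cn.
  rewrite /psi indicE mem_set//= mulr1 ler_pdivlMr// ler_pdivrMr//.
  have /andP[h1 h2] := expRB1_le (s n * c).
  apply/andP; split; first by rewrite mulrC.
  by apply: (le_trans h2); rewrite le_eqVlt; apply/orP; left; apply/eqP; ring.
- exact: cvg_cst.
- by rewrite -[X in _ --> X]mulr1; exact: cvgMl_tmp.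
Qed.

Let dom_int b : mu.-integrable setT (fun u : R => ((expR 1 * `|b * u|)%:E)%E).
Proof.
have ig : mu.-integrable setT (fun u : R => ((expR 1 * b)%:E * u%:E)%E).
  exact: integrableZl.
apply: (le_integrable measurableT _ _ ig) => //.
- apply/measurable_EFinP; apply: measurable_funM => //.
  by apply: measurableT_comp => //; exact: measurable_funM.
- by move=> u _ /=; rewrite lee_fin -mulrA normrM [leRHS]normrM normr_id.
Qed.

Lemma tmgf_cvg b : (tmgf b s s^-1 - 1) / s @[s --> 0^'+] --> b * m.
Proof.
have E s : 0 < s -> (tmgf b s s^-1 - 1) / s = \int[mu]_u psi b s u.
  move=> s0; pose D := [set u | b * u <= s^-1].
  have mD : measurable D by exact: measurable_le_set.
  pose e u := expR (s * (b * u)) * \1_D u.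
  have me : measurable_fun setT e.
    apply: measurable_funM; last exact: measurable_indic.
    by apply: measurableT_comp => //; do 2 apply: measurable_funM => //.
  have ie : mu.-integrable setT (EFin \o e).
    apply: measurable_bounded_integrable => //; first by rewrite (le_lt_trans (probability_le1 _ _))// ltry.
    exists (expR 1); split; first exact: num_real.
    move=> x x1 u _ /=; rewrite /e indicE; have [/set_mem/= bu|nbu] := boolP (u \in _).
      rewrite mulr1 ger0_norm ?expR_ge0// (le_trans _ (ltW x1))// ler_expR.
      by rewrite mulrC -ler_pdivlMr// div1r.
    by rewrite mulr0 normr0 (le_trans _ (ltW x1))// expR_ge0.
  have i1 : mu.-integrable setT (EFin \o cst (1 : R)) by exact: finite_measure_integrable_cst.
  transitivity (\int[mu]_u ((e u - 1) * s^-1)); last by [].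
  rewrite RintegralZr//; last exact: (integrableB measurableT ie i1).
  congr (_ * _); rewrite RintegralB//; congr (_ - _); last first.
    rewrite /Rintegral [X in fine X](_ : _ = 1%E)// integral_cst// mul1e; exact: probability_setT.
  rewrite /tmgf Rintegral_mkcond; apply: eq_Rintegral => u _.
  by rewrite patch_indic.
apply/cvg_at_rightP => s [s0 scvg].
under eq_cvg do rewrite E//.
suff : (\int[mu]_u (psi b (s n) u)%:E @[n --> \oo] --> (b * m)%:E)%E.
  by move=> /fine_cvgP[].
have -> : ((b * m)%:E = \int[mu]_u (b * u)%:E)%E.
  by rewrite EFinM -mu_mean -integralZl.
apply: (@dominated_cvg _ _ _ mu _ measurableT _ _ (fun u => (expR 1 * `|b * u|)%:E)) => //.
- by move=> n; exact/measurable_EFinP.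
- by move=> u _; apply: cvg_EFin; [exact: nearW|exact: psi_cvg].
- by move=> n u _; rewrite lee_fin psi_le.
Qed.

(** A finite first moment makes the tail beyond [s^-1] an [o(s)]: the indicator divided by [s] is
    dominated by a multiple of the modulus of [b * u], and at each [u] it vanishes for small [s]. *)
Lemma tail_cvg0 b : fine (mu [set u | s^-1 < b * u]) / s @[s --> 0^'+] --> (0 : R).
Proof.
have mD s : measurable [set u : R | s^-1 < b * u].
  rewrite (_ : [set _ | _] = ~` [set u : R | b * u <= s^-1]); last first.
    by apply/seteqP; split => u /=; rewrite ltNge => /negP.
  by apply: measurableC; exact: measurable_le_set.
apply/cvg_at_rightP => s [s0 scvg].
suff : (\int[mu]_u (\1_[set u | (s n)^-1 < b * u] u / s n)%:E @[n --> \oo] --> (0 : R)%:E)%E.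
  have E n : (\int[mu]_u (\1_[set u | (s n)^-1 < b * u] u / s n)%:E =
      (fine (mu [set u | (s n)^-1 < b * u]) / s n)%:E)%E.
    under eq_integral do rewrite EFinM muleC.
    rewrite ge0_integralZl//=; last 2 first.
      by apply/measurable_EFinP; exact: measurable_indic.
      by rewrite lee_fin invr_ge0 ltW.
    by rewrite integral_indic// setIT mulrC EFinM fineK//; exact: fin_num_measure.
  by under eq_cvg do rewrite E; move=> /fine_cvgP[].
have -> : ((0 : R)%:E = \int[mu]_u cst 0%:E u)%E by rewrite integral_cst// mul0e.
apply: (@dominated_cvg _ _ _ mu _ measurableT _ _ (fun u => (expR 1 * `|b * u|)%:E)) => //.
- move=> n; apply/measurable_EFinP; apply: measurable_funM => //; exact: measurable_indic.
- move=> u _; apply: cvg_EFin; first exact: nearW.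
  apply: cvg_near_cst.
  have : \forall n \near \oo, s n < (`|b * u| + 1)^-1.
    by apply: (cvgr_lt 0) => //; rewrite invr_gt0 ltr_wpDl.
  apply: filterS => n sn; rewrite /= indicE memNset ?mul0r//= => h.
  move: sn; rewrite -[X in X < _]invrK ltf_pV2 ?posrE ?invr_gt0 ?ltr_wpDl// => h2; move: (lt_trans h2 h).
  by rewrite ltNge => /negP; apply; rewrite (le_trans (ler_norm _))// lerDl.
- move=> n u _; rewrite lee_fin indicE.
  have e1 : 1 <= expR 1 :> R by rewrite -[leLHS]expR0 ler_expR.
  have [/set_mem/= h|_] := boolP (u \in _); last first.
    by rewrite mul0r normr0 mulr_ge0// expR_ge0.
  rewrite mul1r gtr0_norm ?invr_gt0// (le_trans (ltW h))// (le_trans (ler_norm _))//.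
  by rewrite ler_peMl.
Qed.

End truncated_mgf.
Arguments tmgf {R} mu b s z.

Lemma near_pinfty_ge {R : realType} (r : R) : \forall x \near (+oo : set_system R), r <= x.
Proof. by apply: nbhs_pinfty_ge; exact: num_real. Qed.

Lemma near_truncn {R : realType} (Q : nat -> Prop) :
  (\forall n \near \oo, Q n) -> \forall t \near (+oo : set_system R), Q (Num.truncn t).
Proof.
move=> [N _ hN]; near=> t; apply: hN => /=.
by rewrite truncn_ge_nat//; near: t; exact: near_pinfty_ge.
Unshelve. all: by end_near. Qed.

(** * Weak law of large numbers, for random walks and then for Lévy processes *)

Section walk.
Context {R : realType}.
Variables (mu : probability R R) (m : R).
Local Open Scope ereal_scope.

Lemma nnm_expR (s b : R) : nnm (fun x : R => (expR (s * (b * x)))%:E).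
Proof.
split; last by move=> x; rewrite lee_fin expR_ge0.
by apply/measurable_EFinP; apply: measurableT_comp => //; do 2 apply: measurable_funM => //.
Qed.

(** Exponentials are eigenfunctions of convolution operators; the eigenvalue here is [tmgf]. *)
Lemma iter_conv_expR (b s z : R) n x : (0 <= s)%R ->
  iter n (conv mu [set u : R | b * u <= z]%R) (fun x => (expR (s * (b * x)))%:E) x =
  (tmgf mu b s z ^+ n * expR (s * (b * x)))%:E.
Proof.
move=> s0; pose D := [set u : R | b * u <= z]%R.
have mD : measurable D by exact: measurable_le_set.
have me : measurable_fun setT (fun u : R => expR (s * (b * u))).
  by apply: measurableT_comp => //; do 2 apply: measurable_funM => //.
have E y : conv mu D (fun x => (expR (s * (b * x)))%:E) y =
    (tmgf mu b s z * expR (s * (b * y)))%:E.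
  rewrite EFinM /tmgf /Rintegral fineK; last first.
    apply: integrable_fin_num => //.
    apply: measurable_bounded_integrable => //.
    - by rewrite (le_lt_trans (probability_le1 _ _))// ltry.
    - exact: measurable_funS me.
    - exists (expR (s * z)); split; first exact: num_real.
      move=> c c1 u /= Du; rewrite ger0_norm ?expR_ge0// (le_trans _ (ltW c1))// ler_expR.
      by rewrite ler_wpM2l.
  rewrite muleC -ge0_integralZl//; last first.
    by apply/measurable_EFinP; exact: measurable_funS me.
  by apply: eq_integral => u _; rewrite -EFinM -expRD; congr (expR _)%:E; ring.
elim: n x => [|n ih] x; first by rewrite expr0 mul1r.
rewrite /= (_ : iter n _ _ = fun y => (tmgf mu b s z ^+ n)%:E * (expR (s * (b * y)))%:E); last first.
  by apply/funext => y; rewrite ih.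
rewrite convZ//; last 2 first.
  by apply: exprn_ge0; apply: Rintegral_ge0 => u _; exact: expR_ge0.
  exact: nnm_expR.
by rewrite -/D E -EFinM exprS; congr EFin; ring.
Qed.

Lemma tmgf_ge0 (b s z : R) : (0 <= tmgf mu b s z)%R.
Proof. by apply: Rintegral_ge0 => u _; exact: expR_ge0. Qed.

Hypothesis mu_int : mu.-integrable setT (EFin : R -> \bar R).
Hypothesis mu_mean : \int[mu]_u u%:E = m%:E.

Lemma measurable_gt_set (b z : R) : measurable [set u : R | (z < b * u)%R].
Proof.
rewrite (_ : [set _ | _] = ~` [set u : R | (b * u <= z)%R]); last first.
  by apply/seteqP; split => u /=; rewrite ltNge => /negP.
by apply: measurableC; exact: measurable_le_set.
Qed.

Lemma near_tmgf_le (b e : R) : (0 < e)%R ->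
  \forall s \near (0 : R)^'+, (tmgf mu b s s^-1 <= 1 + (b * m + e) * s)%R.
Proof.
move=> e0; have /cvgr_le/(_ (b * m + e)%R) := tmgf_cvg _ _ mu_int mu_mean b.
rewrite ltrDl => /(_ e0) H; near=> s.
have s0 : (0 < s)%R by near: s; exact: nbhs_right_gt.
rewrite -lerBlDl -ler_pdivrMr//; near: s; exact: H.
Unshelve. all: by end_near. Qed.

(* Chernoff's bound for the jumps truncated at [s^-1], with [s = K / n]: the
   truncation is needed as only the first moment is finite. *)
Lemma walk_weak_lln (b e c : R) : (0 < e)%R -> (0 < c)%R ->
  \forall n \near \oo, iter n.+1 (conv mu setT)
    (fun x => (\1_[set x : R | ((b * m + e) * n.+1%:R < b * x)%R] x)%:E) 0%R <= c%:E.
Proof.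
move=> e0 c0.
(* After [n.+1] steps Chernoff's bound will be [expR (- (e / 2 * K))]; [K] makes it at most half of
   [c]. *)
have [K K0 Kc] : exists2 K : R, (0 < K)%R & (expR (- (e / 2 * K)) <= c / 2)%R.
  exists (Num.max 1%R ((e / 2)^-1 * - ln (c / 2)))%R; first by rewrite lt_max ltr01.
  rewrite -[leRHS](@lnK _ (c / 2)%R) ?posrE ?divr_gt0// ler_expR lerNl -ler_pdivrMl ?divr_gt0//.
  by rewrite le_max lexx orbT.
pose s n : R := (K / n.+1%:R)%R.
have s0 n : (0 < s n)%R by rewrite divr_gt0.
have scvg : s n @[n --> \oo] --> (0 : R)%R.
  by rewrite -(mulr0 K); apply: cvgMl_tmp; exact: cvg_harmonic.
have scvg' : s n @[n --> \oo] --> (0 : R)^'+.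
  move=> A HA; have h : \forall n \near \oo, ((0 < s n)%R -> A (s n)) := scvg _ HA.
  by apply: filterS h => n /(_ (s0 n)).
have e2 : (0 < e / 2)%R by rewrite divr_gt0.
have H1 := near_tmgf_le b _ e2.
have H2 : \forall n \near \oo, (tmgf mu b (s n) (s n)^-1 <= 1 + (b * m + e / 2) * s n)%R.
  exact: scvg' H1.
have H3 : \forall n \near \oo, (fine (mu [set u | ((s n)^-1 < b * u)%R]) / s n <= c / 2 / K)%R.
  have /cvgr_le/(_ (c / 2 / K)%R) := tail_cvg0 _ mu_int b.
  by rewrite !divr_gt0// => /(_ isT) H; exact: scvg' H.
near=> n.
pose D := [set u : R | b * u <= (s n)^-1]%R.
have mD : measurable D by exact: measurable_le_set.
have DC : ~` D = [set u | ((s n)^-1 < b * u)%R].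
  by apply/seteqP; split => u /=; rewrite ltNge => /negP.
pose f x : \bar R := (\1_[set x : R | ((b * m + e) * n.+1%:R < b * x)%R] x)%:E.
have nf : nnm f by apply: nnm_indic; exact: measurable_gt_set.
apply: (le_trans (iter_conv_le mu D _ _ _ mD nf)).
have -> : c = (c / 2 + c / 2)%R by lra.
rewrite EFinD leeD//.
- pose k := expR (- (s n * ((b * m + e) * n.+1%:R)))%R.
  pose g x : \bar R := k%:E * (expR (s n * (b * x)))%:E.
  have ng : nnm g by apply: nnmZ; [exact: expR_ge0|exact: nnm_expR].
  apply: (@le_trans _ _ (iter n.+1 (conv mu D) g 0%R)).
    apply: le_iter_conv => // y; rewrite /f /g -EFinM lee_fin /k -expRD indicE.
    have [/set_mem/= h|_] := boolP (y \in _); last by rewrite expR_ge0.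
    by rewrite -[leLHS]expR0 ler_expR addrC -mulrBr mulr_ge0// ?ltW// subr_gt0.
  rewrite /g iter_convZ//; [|exact: expR_ge0|exact: nnm_expR].
  rewrite iter_conv_expR; last exact/ltW/s0.
  rewrite -EFinM lee_fin !mulr0 expR0 mulr1.
  have h : (tmgf mu b (s n) (s n)^-1 <= expR ((b * m + e / 2) * s n))%R.
    by rewrite (le_trans _ (expR_ge1Dx _))//; near: n.
  rewrite (le_trans _ Kc)// (@le_trans _ _ (k * (expR ((b * m + e / 2) * s n)) ^+ n.+1)%R)//.
    by rewrite ler_wpM2l ?expR_ge0// lerXn2r// ?nnegrE ?expR_ge0 ?tmgf_ge0.
  rewrite /k -expRM_natl -expRD ler_expR.
  have -> : (K = s n * n.+1%:R)%R by rewrite /s mulfVK.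
  by rewrite le_eqVlt; apply/orP; left; apply/eqP; field.
(* Some jump exceeds the cutoff [n.+1 / K]: the union bound over the [n.+1] steps is small because
   the tail beyond [s^-1] is [o(s)] and [n.+1 = K / s]. *)
- have : (fine (mu (~` D)) * n.+1%:R <= c / 2)%R.
    rewrite (_ : _ * _ = fine (mu (~` D)) / s n * K)%R; last first.
      by rewrite /s invf_div; field; rewrite lt0r_neq0.
    by rewrite -ler_pdivlMr// DC; near: n.
  rewrite -lee_fin => h; apply: (le_trans _ h); rewrite mulrC EFinM lee_wpmul2l ?lee_fin//.
  have fC : mu (~` D) = (fine (mu (~` D)))%:E.
    by rewrite fineK//; apply: fin_num_measure; exact: measurableC.
  apply: (@le_trans _ _ (iter n (conv mu setT) (cst (fine (mu (~` D)))%:E) 0%R)).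
    apply: le_iter_conv => //.
    + by apply: nnm_conv => //; exact: measurableC.
    + by apply: nnm_cst; rewrite lee_fin fine_ge0.
    + move=> y; rewrite -fC -[leRHS]mul1e -(conv_cst mu _ 1%R y); last exact: measurableC.
      apply: le_conv => //; first exact: measurableC.
      by move=> u _; rewrite /f lee_fin indicE lern1 leq_b1.
  by apply: iter_conv_cst => //; exact: fine_ge0.
Unshelve. all: by end_near. Qed.

End walk.

Section levy_weak_lln.
Context {d : measure_display} {T : measurableType d} {R : realType}.
Context {P : probability T R} {xi : R -> {RV P >-> R}}.
Hypothesis xi_levy : levy_process xi.
Variable m : R.
Hypothesis xi_int : (law xi 1).-integrable setT (EFin : R -> \bar R).
Hypothesis xi_mean : (\int[law xi 1]_u u%:E = m%:E)%E.
Local Open Scope ereal_scope.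

Lemma law_nat n f x : nnm f ->
  conv (law xi n.+1%:R) setT f x = iter n.+1 (conv (law xi 1%R) setT) f x.
Proof.
by move=> nf; rewrite iterSr iter_conv_law// natr1.
Qed.

Lemma truncn_frac (t : R) : (0 <= t)%R -> (0 <= (Num.truncn t).+1%:R - t <= 1)%R.
Proof.
move=> t0; have /andP[h1 h2] := truncn_itv t0.
by rewrite subr_ge0 (ltW h2) lerBlDl -natr1 lerD2r.
Qed.

(** Passage from integer to real times. From [t] to the integer [(Num.truncn t).+1] the increment
    stays within [N] with probability at least [p], so a deviation at [t] is at most [p^-1] times as
    likely as one of the walk. Half of [e * t] absorbs [N] and the rounding. *)
Let half (b e c : R) : `|b|%R = 1%R -> (0 < e)%R -> (0 < c)%R ->
  \forall t \near (+oo%R : set_system R), law xi t [set x | ((b * m + e) * t < b * x)%R] <= c%:E.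
Proof.
move=> b1 e0 c0.
have [N [p [N0 p0 hp]]] := law_cball_ge xi_levy.
have e2 : (0 < e / 2)%R by rewrite divr_gt0.
have pc : (0 < p * c)%R by rewrite mulr_gt0.
have H := near_truncn _ (walk_weak_lln _ m xi_int xi_mean b _ _ e2 pc).
near=> t.
have t0 : (0 <= t)%R by near: t; exact: near_pinfty_ge.
have tbig : ((e / 2)^-1 * (`|b * m + e| + N) <= t)%R by near: t; exact: near_pinfty_ge.
have Ht : iter (Num.truncn t).+1 (conv (law xi 1%R) setT)
    (fun x => (\1_[set x : R | ((b * m + e / 2) * (Num.truncn t).+1%:R < b * x)%R] x)%:E) 0%R
    <= (p * c)%:E by near: t; exact: H.
have /andP[r0 r1] := truncn_frac t t0.
set n := Num.truncn t in r0 r1.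
pose A := [set x | ((b * m + e) * t < b * x)%R].
pose A' := [set x | ((b * m + e / 2) * n.+1%:R < b * x)%R].
have mA : measurable A by exact: measurable_gt_set.
have mA' : measurable A' by exact: measurable_gt_set.
have large : ((b * m + e / 2) * n.+1%:R <= (b * m + e) * t - N)%R.
  have h : (`|b * m + e| + N <= e / 2 * n.+1%:R)%R.
    by rewrite -ler_pdivrMl// (le_trans tbig)// -subr_ge0.
  have h2 : ((b * m + e) * (n.+1%:R - t) <= `|b * m + e|)%R.
    rewrite (le_trans (ler_norm _))// normrM ler_piMr// ger0_norm//.
  have -> : ((b * m + e) * t = (b * m + e) * n.+1%:R - (b * m + e) * (n.+1%:R - t))%R by ring.
  have -> : ((b * m + e) * n.+1%:R = (b * m + e / 2) * n.+1%:R + e / 2 * n.+1%:R)%R by field.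
  by lra.
rewrite -(@lee_pmul2l _ p%:E)// -EFinM -/A -(conv_indic _ _ mA).
apply: (@le_trans _ _ (conv (law xi n.+1%:R) setT (fun x => (\1_A' x)%:E) 0%R)).
  have -> : (n.+1%:R = t + (n.+1%:R - t))%R by rewrite addrC subrK.
  apply: (conv_lawD_ge xi_levy _ _ _ (`[(- N)%R, N]%classic : set R)) => //; [exact: ltW|exact: nnm_indic|exact: nnm_indic| |].
    move=> y u; rewrite /= in_itv/= -ler_norml => uN; rewrite lee_fin; apply: le_indic; rewrite /A /A' /= => h.
    have bu : (- N <= b * u)%R.
      by have : (`|b * u| <= N)%R; [rewrite normrM b1 mul1r|rewrite ler_norml => /andP[]].
    by rewrite mulrDr (le_lt_trans large)//; lra.
  by apply: hp; rewrite r0.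
by rewrite law_nat//; exact: nnm_indic.
Unshelve. all: by end_near. Qed.

Lemma law_weak_lln (e c : R) : (0 < e)%R -> (0 < c)%R ->
  \forall t \near (+oo%R : set_system R), law xi t [set x | (e * t < `|x - m * t|)%R] <= c%:E.
Proof.
move=> e0 c0; have c2 : (0 < c / 2)%R by rewrite divr_gt0.
have H1 := half 1 e _ (normr1 _) e0 c2.
have H2 := half (-1) e _ (normrN1 _) e0 c2.
near=> t.
have mA b : measurable [set x | ((b * m + e) * t < b * x)%R] by exact: measurable_gt_set.
apply: (@le_trans _ _ (law xi t ([set x | ((1 * m + e) * t < 1 * x)%R] `|`
    [set x | ((- 1 * m + e) * t < - 1 * x)%R]))).
  apply: le_measure; rewrite ?inE//; last 2 first.
    exact: measurableU.
    move=> x /=; rewrite real_ltr_normr ?num_real// => /orP[h|h]; [left|right] => /=; lra.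
  rewrite (_ : [set _ | _] = [set x | ((1 * m + e) * t < 1 * x)%R] `|`
    [set x | ((- 1 * m + e) * t < - 1 * x)%R]); first exact: measurableU.
  apply/seteqP; split => x /=; rewrite real_ltr_normr ?num_real//.
    by move=> /orP[h|h]; [left|right] => /=; lra.
  by move=> [h|h]; apply/orP; [left|right]; lra.
rewrite (le_trans (measureU2 _ _ _))// (_ : c = c / 2 + c / 2)%R; last by lra.
by rewrite EFinD leeD//; near: t.
Unshelve. all: by end_near. Qed.

End levy_weak_lln.

(** * Contractions and regular variation at infinity *)

Section asymptotics.
Context {R : realType}.

Lemma near_affine (Q : R -> Prop) (k b : R) : 0 < k ->
  (\forall x \near +oo, Q x) -> \forall x \near +oo, Q (k * x + b).
Proof.
move=> k0 [M [_ hM]]; near=> x; apply: hM.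
rewrite -ltrBlDr -ltr_pdivrMl//; near: x; apply: nbhs_pinfty_gt; exact: num_real.
Unshelve. all: by end_near. Qed.

Lemma cvg_affine (f : R -> R) (l k b : R) : 0 < k ->
  f x @[x --> +oo] --> l -> f (k * x + b) @[x --> +oo] --> l.
Proof. by move=> k0 fl A /fl h; exact: (near_affine (fun x => A (f x))). Qed.

Lemma cvg_scale (f : R -> R) (l k : R) : 0 < k ->
  f x @[x --> +oo] --> l -> f (k * x) @[x --> +oo] --> l.
Proof.
by move=> k0 /(cvg_affine _ _ _ 0 k0); under eq_fun do rewrite addr0.
Qed.

Lemma cvg_shift (f : R -> R) (l b : R) :
  f x @[x --> +oo] --> l -> f (x + b) @[x --> +oo] --> l.
Proof.
by move=> /(cvg_affine _ _ _ b (@ltr01 R)); under eq_fun do rewrite mul1r.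
Qed.

(** The recursion is unrolled [K] times and the errors are summed as a geometric series. Each use
    shifts the argument by [c], possibly downwards, hence the margin required above [Y]. *)
Lemma contraction_iter (v : R -> R) (Y M r e c : R) K : 0 <= r < 1 -> 0 <= e ->
  (forall y, Y <= y -> v y <= M) ->
  (forall y, Y <= y -> v y <= r * v (y + c) + e) ->
  forall y, Y + K%:R * `|c| <= y -> v y <= r ^+ K * M + e / (1 - r).
Proof.
move=> /andP[r0 r1] e0 vM vr; have r1' : 0 < 1 - r by rewrite subr_gt0.
elim: K => [|K ih] y.
  rewrite mul0r addr0 expr0 mul1r => Yy.
  by rewrite (le_trans (vM _ Yy))// lerDl divr_ge0// ltW.
rewrite -natr1 mulrDl mul1r => Yy.
have Kc : 0 <= K%:R * `|c| by rewrite mulr_ge0.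
have h1 : Y <= y by have := normr_ge0 c; lra.
have h2 : Y + K%:R * `|c| <= y + c by have := ler_norm (- c); rewrite normrN; lra.
rewrite (le_trans (vr _ h1))// (@le_trans _ _ (r * (r ^+ K * M + e / (1 - r)) + e))//.
  by rewrite lerD2r ler_wpM2l// ih.
rewrite le_eqVlt; apply/orP; left; apply/eqP; rewrite exprS.
by field; rewrite lt0r_neq0.
Qed.

Lemma exprn_le_small (r M e : R) : 0 <= r < 1 -> 0 < e -> exists K, r ^+ K * M <= e.
Proof.
move=> /andP[r0 r1] e0.
have h : r ^+ n * M @[n --> \oo] --> (0 : R).
  by rewrite -(mul0r M); apply: cvgMr_tmp; apply: cvg_expr; rewrite ger0_norm.
have [K _ hK] := cvgr_le _ h _ e0.
by exists K; apply: hK => /=.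
Qed.

Lemma contraction_pinfty (v : R -> R) (Y M r e c e' : R) : 0 <= r < 1 -> 0 <= e ->
  (forall y, Y <= y -> v y <= M) ->
  (forall y, Y <= y -> v y <= r * v (y + c) + e) ->
  0 < e' -> \forall y \near +oo, v y <= e / (1 - r) + e'.
Proof.
move=> r01 e0 vM vr e'0; have [K hK] := exprn_le_small r M _ r01 e'0.
near=> y; rewrite addrC (@le_trans _ _ (r ^+ K * M + e / (1 - r)))//; last by rewrite lerD2r.
exact: (contraction_iter v Y M r e c).
Unshelve. all: by end_near. Qed.

(** As the recursion holds on the whole line, [Y] may be taken as far below [y] as [K] requires;
    letting [K] grow removes [M] from the bound. *)
Lemma contraction_bound (v : R -> R) (M r e c : R) : 0 <= r < 1 -> 0 <= e ->
  (forall y, v y <= M) -> (forall y, v y <= r * v (y + c) + e) ->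
  forall y, v y <= e / (1 - r).
Proof.
move=> r01 e0 vM vr y; apply/ler_addgt0Pr => e' e'0.
have [K hK] := exprn_le_small r M _ r01 e'0.
rewrite addrC (@le_trans _ _ (r ^+ K * M + e / (1 - r)))//; last by rewrite lerD2r.
by apply: (contraction_iter v (y - K%:R * `|c|) M r e c) => //; rewrite subrK.
Qed.

Lemma near_le_powR (C e : R) : 0 < e -> \forall x \near +oo, C <= x `^ e.
Proof.
move=> e0; near=> x; rewrite (@le_trans _ _ (`|C| `^ (e^-1) `^ e))//.
  by rewrite -powRrM mulVf ?gt_eqF// powRr1// ler_norm.
have x0 : 0 <= x by near: x; exact: near_pinfty_ge.
have xC : `|C| `^ e^-1 <= x by near: x; exact: near_pinfty_ge.
by apply: ge0_ler_powR; rewrite ?nnegrE ?powR_ge0// ltW.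
Unshelve. all: by end_near. Qed.

Lemma near_ln_le (e : R) : 0 < e -> \forall x \near +oo, ln x <= e * x.
Proof.
move=> e0; near=> x.
have x0 : 0 < x by near: x; apply: nbhs_pinfty_gt; exact: num_real.
have h : 2 / e <= x `^ 2^-1 by near: x; apply: near_le_powR; rewrite invr_gt0.
have := ln_sublinear (powR_gt0 2^-1 x0); rewrite ln_powR => h2.
have E : x = x `^ 2^-1 * x `^ 2^-1.
  by rewrite -powRD ?gt_eqF ?implybT// (_ : 2^-1 + 2^-1 = 1) ?powRr1 ?ltW//; lra.
have p0 := powR_gt0 2^-1 x0.
rewrite (@le_trans _ _ (2 * x `^ 2^-1))//; first lra.
rewrite [in leRHS]E mulrA ler_pM2r//.
by move: h; rewrite ler_pdivrMr// mulrC.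
Unshelve. all: by end_near. Qed.

Lemma near_expR_le_powR (c g : R) : 0 < c -> \forall x \near +oo, expR (- (c * x)) <= x `^ (- g).
Proof.
move=> c0; near=> x.
have x1 : 1 < x by near: x; apply: nbhs_pinfty_gt; exact: num_real.
have x0 : 0 < x by exact: lt_trans x1.
have l0 : 0 <= ln x by rewrite ln_ge0// ltW.
have g0 : 0 < `|g| + 1 by rewrite ltr_wpDl.
have h : ln x <= c / (`|g| + 1) * x.
  by near: x; apply: near_ln_le; rewrite divr_gt0.
rewrite /powR gt_eqF// ler_expR mulNr lerN2 (@le_trans _ _ ((`|g| + 1) * ln x))//.
  by rewrite ler_wpM2r// (le_trans (ler_norm _))// lerDl.
by rewrite -ler_pdivlMl// mulrA (mulrC _^-1).
Unshelve. all: by end_near. Qed.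

(** Repeated halving brings [x] into [[X, 2 * X]], and [h] does not decrease on the way. *)
Lemma doubling_le (h : R -> R) (X C : R) : 0 < X ->
  (forall x, X <= x <= 2 * X -> h x <= C) -> (forall x, X <= x -> h (2 * x) <= h x) ->
  forall x, X <= x -> h x <= C.
Proof.
move=> X0 hC h2 x Xx.
have H n y : X <= y <= 2 ^+ n.+1 * X -> h y <= C.
  elim: n y => [|n ih] y; first by rewrite expr1; exact: hC.
  move=> /andP[Xy yn]; have [y2|y2] := leP y (2 * X); first by apply: hC; rewrite Xy.
  have -> : y = 2 * (y / 2) by field.
  rewrite (le_trans (h2 _ _))//; first by lra.
  apply: ih; apply/andP; split; first lra.
  by rewrite ler_pdivrMr// mulrAC -exprSr.
have : x / X <= 2 ^+ (Num.truncn (x / X)).+1.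
  by rewrite -natrX (le_trans (ltW (truncnS_gt _)))// ler_nat ltnW// ltn_expl.
by rewrite ler_pdivrMr// => h3; apply: (H (Num.truncn (x / X))); rewrite Xx.
Qed.

End asymptotics.

(** * Regular variation of the tail and Potter-type bounds *)

Section regular_variation.
Context {R : realType}.
Variables (F l : R -> R) (alpha : R).
Hypothesis F_ge0 : forall x, 0 <= F x.
Hypothesis F_ni : forall x y, x <= y -> F y <= F x.
Hypothesis l_sv : slowly_varying l.
Hypothesis F_rv : asymp_equiv F (fun x => x `^ (- alpha) * l x).

Let l_gt0 : \forall x \near +oo, 0 < l x.
Proof.
have [[X [_ lX]] _] := l_sv.
by near=> x; apply: lX; near: x; exact: near_pinfty_ge.
Unshelve. all: by end_near. Qed.

Lemma rv_gt0 x : 0 < F x.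
Proof.
have : \forall y \near +oo, 0 < F y.
  have := cvgr_gt _ F_rv 0 (@ltr01 R) => H; near=> y.
  have : 0 < F y / (y `^ (- alpha) * l y) by near: y; exact: H.
  by move=> h; rewrite lt0r F_ge0 andbT; apply/eqP => F0; move: h; rewrite F0 mul0r ltxx.
move=> [M [_ hM]].
have xm : x <= Num.max x (M + 1) by rewrite le_max lexx.
apply: lt_le_trans (F_ni _ _ xm); apply: hM.
by rewrite lt_max ltrDl ltr01 orbT.
Unshelve. all: by end_near. Qed.

Lemma rv_scale k : 0 < k -> F (k * x) / F x @[x --> +oo] --> k `^ (- alpha).
Proof.
move=> k0.
pose H x := x `^ (- alpha) * l x.
have h1 : F (k * x) / H (k * x) @[x --> +oo] --> (1 : R) by exact: (cvg_scale (fun x => F x / H x)).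
have h2 : l (k * x) / l x @[x --> +oo] --> (1 : R) by apply: l_sv.2.
have h3 : (F x / H x)^-1 @[x --> +oo] --> (1 : R)^-1 by apply: cvgV => //; exact: oner_neq0.
have h4 : F (k * x) / H (k * x) * (k `^ (- alpha) * (l (k * x) / l x)) * (F x / H x)^-1
    @[x --> +oo] --> 1 * (k `^ (- alpha) * 1) * (1 : R)^-1.
  by apply: cvgM => //; apply: cvgM => //; apply: cvgMl_tmp.
have lk : \forall x \near +oo, 0 < l (k * x).
  by apply: filterS (near_affine (fun x => 0 < l x) k 0 k0 l_gt0) => x; rewrite addr0.
rewrite invr1 !mulr1 mul1r in h4; apply: cvg_trans h4; apply: near_eq_cvg; near=> x.
have x0 : 0 < x by near: x; apply: nbhs_pinfty_gt; exact: num_real.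
have lx : 0 < l x by near: x.
have lkx : 0 < l (k * x) by near: x; exact: lk.
rewrite /H powRM ?ltW//.
have p1 := powR_gt0 (- alpha) k0; have p2 := powR_gt0 (- alpha) x0; have p3 := rv_gt0 x.
by field; rewrite !gt_eqF.
Unshelve. all: by end_near. Qed.

(** With [b'] between [b] and [alpha], [F x * x ^ b'] eventually does not grow under doubling, and
    monotonicity of [F] bounds it on [[X, 2 * X]]. The gap [b' - b] then absorbs the constant. *)
Lemma rv_potter_upper b : b < alpha -> \forall x \near +oo, F x <= x `^ (- b).
Proof.
move=> ba; pose b' := (b + alpha) / 2.
have bb' : b < b' by rewrite /b'; lra.
have b'a : b' < alpha by rewrite /b'; lra.
have h : \forall x \near +oo, F (2 * x) <= 2 `^ (- b') * F x.
  have := cvgr_le _ (rv_scale 2 (ltr0n _ 2)) (2 `^ (- b')).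
  rewrite /powR pnatr_eq0/= ltr_expR ltr_pM2r ?ln_gt0 ?ltr1n// ltrN2 => /(_ _ b'a) h.
  by apply: filterS (h) => x; rewrite ler_pdivrMr ?rv_gt0.
have [M [_ hM]] := h.
pose X := Num.max 1 (M + 1).
have X0 : 0 < X by rewrite lt_max ltr01.
have hX x : X <= x -> F (2 * x) <= 2 `^ (- b') * F x.
  by move=> Xx; apply: hM; rewrite (lt_le_trans _ Xx)// lt_max ltrDl ltr01 orbT.
(* Two candidates because [b'] may be negative, in which case the power is largest at the left end
   of [[X, 2 * X]]. *)
pose C := Num.max (F X * X `^ b') (F X * (2 * X) `^ b').
have hC x : X <= x -> F x * x `^ b' <= C.
  apply: (doubling_le (fun x => F x * x `^ b') X C X0) => {}x.
    move=> /andP[Xx x2X]; rewrite /C le_max.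
    have x0 := lt_le_trans X0 Xx.
    have [b0|b0] := leP 0 b'.
      apply/orP; right; rewrite ler_pM ?powR_ge0 ?F_ni//.
      by apply: ge0_ler_powR => //; rewrite nnegrE ltW// mulr_gt0.
    apply/orP; left; rewrite ler_pM ?powR_ge0 ?F_ni//.
    rewrite -(opprK b') (powRN x) (powRN X) lef_pV2 ?posrE ?powR_gt0//.
    by apply: ge0_ler_powR => //; rewrite ?nnegrE ltW// oppr_gt0.
  move=> Xx; have x0 := lt_le_trans X0 Xx.
  rewrite powRM ?(ltW x0)// (@le_trans _ _ (2 `^ (- b') * F x * (2 `^ b' * x `^ b')))//.
    by rewrite ler_wpM2r ?mulr_ge0 ?powR_ge0// hX.
  rewrite powRN le_eqVlt; apply/orP; left; apply/eqP; field.
  by rewrite gt_eqF// powR_gt0.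
have e0 : 0 < - b + b' by lra.
near=> x.
have x0 : 0 < x by near: x; apply: nbhs_pinfty_gt; exact: num_real.
have Xx : X <= x by near: x; exact: near_pinfty_ge.
have Cx : C <= x `^ (- b + b') by near: x; exact: near_le_powR.
rewrite -(@ler_pM2r _ (x `^ b')) ?powR_gt0// -powRD ?(gt_eqF x0) ?implybT//.
exact: le_trans (hC _ Xx) Cx.
Unshelve. all: by end_near. Qed.

Lemma rv_potter_lower b : alpha < b -> \forall x \near +oo, x `^ (- b) <= F x.
Proof.
move=> ba; pose b' := (b + alpha) / 2.
have bb' : b' < b by rewrite /b'; lra.
have b'a : alpha < b' by rewrite /b'; lra.
have h : \forall x \near +oo, 2 `^ (- b') * F x <= F (2 * x).
  have := cvgr_ge _ (rv_scale 2 (ltr0n _ 2)) (2 `^ (- b')).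
  rewrite /powR pnatr_eq0/= ltr_expR ltr_pM2r ?ln_gt0 ?ltr1n// ltrN2 => /(_ _ b'a) h.
  by apply: filterS (h) => x; rewrite ler_pdivlMr ?rv_gt0.
have [M [_ hM]] := h.
pose X := Num.max 1 (M + 1).
have X0 : 0 < X by rewrite lt_max ltr01.
have hX x : X <= x -> 2 `^ (- b') * F x <= F (2 * x).
  by move=> Xx; apply: hM; rewrite (lt_le_trans _ Xx)// lt_max ltrDl ltr01 orbT.
pose C := Num.min (F (2 * X) * X `^ b') (F (2 * X) * (2 * X) `^ b').
have C0 : 0 < C by rewrite lt_min !mulr_gt0// ?rv_gt0 ?powR_gt0 ?mulr_gt0.
have hC x : X <= x -> C <= F x * x `^ b'.
  move=> Xx; rewrite -lerN2; move: x Xx; apply: (doubling_le (fun x => - (F x * x `^ b')) X (- C) X0) => x.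
    move=> /andP[Xx x2X]; rewrite lerN2 /C ge_min.
    have x0 := lt_le_trans X0 Xx.
    have [b0|b0] := leP 0 b'.
      apply/orP; left; rewrite ler_pM ?powR_ge0 ?F_ni//.
      by apply: ge0_ler_powR => //; rewrite nnegrE ltW.
    apply/orP; right; rewrite ler_pM ?powR_ge0 ?F_ni//.
    rewrite -(opprK b') (powRN x) (powRN (2 * X)) lef_pV2 ?posrE ?powR_gt0 ?mulr_gt0//.
    by apply: ge0_ler_powR => //; rewrite ?nnegrE ltW// ?oppr_gt0 ?mulr_gt0.
  move=> Xx; have x0 := lt_le_trans X0 Xx.
  rewrite lerN2 powRM ?(ltW x0)// (@le_trans _ _ (2 `^ (- b') * F x * (2 `^ b' * x `^ b')))//.
    rewrite powRN le_eqVlt; apply/orP; left; apply/eqP; field.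
    by rewrite gt_eqF// powR_gt0.
  by rewrite ler_wpM2r ?mulr_ge0 ?powR_ge0// hX.
have e0 : 0 < b - b' by lra.
near=> x.
have x0 : 0 < x by near: x; apply: nbhs_pinfty_gt; exact: num_real.
have Xx : X <= x by near: x; exact: near_pinfty_ge.
have Cx : C^-1 <= x `^ (b - b') by near: x; exact: near_le_powR.
rewrite -(@ler_pM2r _ (x `^ b')) ?powR_gt0// -powRD ?(gt_eqF x0) ?implybT//.
rewrite (le_trans _ (hC _ Xx))// (_ : - b + b' = - (b - b')); last by ring.
by rewrite powRN -[leRHS]invrK lef_pV2// posrE ?invr_gt0 ?powR_gt0.
Unshelve. all: by end_near. Qed.

End regular_variation.

(** * Local asymptotics of the tail and of exponential functionals *)

Section local_asymptotics.
Context {R : realType}.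
Variables (F : R -> R) (alpha : R).
Hypothesis alpha_gt0 : 0 < alpha.
Hypothesis F_gt0 : forall x, 0 < F x.
Hypothesis F_ni : forall x y, x <= y -> F y <= F x.
Hypothesis F_scale : forall k, 0 < k -> F (k * x) / F x @[x --> +oo] --> k `^ (- alpha).

(** It acts as a density of [xi_1] at large [x]: the interval []x, x + delta]] has mass equivalent
    to [delta * locd F alpha x]. *)
Definition locd (F : R -> R) (alpha x : R) : R := alpha / x * F x.
Local Notation q := (locd F alpha).

Hypothesis F_loc : forall b, 0 < b -> (F y - F (y + b)) / q y @[y --> +oo] --> b.

Lemma near_pinfty_gt (r : R) : \forall x \near +oo, r < x.
Proof. by apply: nbhs_pinfty_gt; exact: num_real. Qed.

Lemma cvg_inv_pinfty : (x : R)^-1 @[x --> +oo] --> (0 : R).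
Proof.
by apply/(@gtr0_cvgV0 _ _ _ _ (fun x : R => x)); [exact: near_pinfty_gt|exact: cvg_id].
Qed.

Lemma locd_gt0 x : 0 < x -> 0 < q x.
Proof. by move=> x0; rewrite mulr_gt0// divr_gt0. Qed.

Lemma locd_ni x y : 0 < x -> x <= y -> q y <= q x.
Proof.
move=> x0 xy; have y0 := lt_le_trans x0 xy.
rewrite /locd ler_pM ?F_ni ?(ltW (F_gt0 _)) ?(ltW (divr_gt0 _ _))//.
by rewrite ler_pM2l// lef_pV2.
Qed.

Lemma locd_scale k : 0 < k -> q (k * x) / q x @[x --> +oo] --> k^-1 * k `^ (- alpha).
Proof.
move=> k0.
have : k^-1 * (F (k * x) / F x) @[x --> +oo] --> k^-1 * k `^ (- alpha).
  by apply: cvgMl_tmp; exact: F_scale.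
apply: cvg_trans; apply: near_eq_cvg; near=> x.
have x0 : 0 < x by near: x; exact: near_pinfty_gt.
by rewrite /locd; field; rewrite !gt_eqF ?mulr_gt0.
Unshelve. all: by end_near. Qed.

(** The mass of []x, x + b]] is about [b * alpha * F x / x], negligible against [F x]. *)
Let F_shift_pos b : 0 < b -> F (x + b) / F x @[x --> +oo] --> (1 : R).
Proof.
move=> b0.
have : 1 - (F x - F (x + b)) / q x * (alpha * x^-1) @[x --> +oo] --> (1 - b * (alpha * 0) : R).
  apply: cvgB; first exact: cvg_cst.
  by apply: cvgM; [exact: F_loc|apply: cvgMl_tmp; exact: cvg_inv_pinfty].
rewrite !mulr0 subr0; apply: cvg_trans; apply: near_eq_cvg; near=> x.
have x0 : 0 < x by near: x; exact: near_pinfty_gt.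
by rewrite /locd; field; rewrite !gt_eqF ?mulr_gt0.
Unshelve. all: by end_near. Qed.

Lemma F_shift b : F (x + b) / F x @[x --> +oo] --> (1 : R).
Proof.
have [b0|b0|<-] := ltgtP 0 b; first exact: F_shift_pos.
  have nb : 0 < - b by rewrite oppr_gt0.
  have : (F (x + b - b) / F (x + b))^-1 @[x --> +oo] --> (1 : R)^-1.
    apply: cvgV; first exact: oner_neq0.
    exact: (cvg_shift (fun x => F (x - b) / F x) 1 b (F_shift_pos _ nb)).
  rewrite invr1; apply: cvg_trans; apply: near_eq_cvg; near=> x.
  by rewrite addrK invf_div.
by apply: cvg_near_cst; near=> x; rewrite addr0 divff// gt_eqF.
Unshelve. all: by end_near. Qed.

Lemma locd_shift b : q (x + b) / q x @[x --> +oo] --> (1 : R).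
Proof.
have : (1 - b * (x + b)^-1) * (F (x + b) / F x) @[x --> +oo] --> ((1 - b * 0) * 1 : R).
  apply: cvgM; last exact: F_shift.
  apply: cvgB; first exact: cvg_cst.
  by apply: cvgMl_tmp; exact: (cvg_shift _ _ b cvg_inv_pinfty).
rewrite mulr0 subr0 mulr1; apply: cvg_trans; apply: near_eq_cvg; near=> x.
have x0 : 0 < x by near: x; exact: near_pinfty_gt.
have xb : 0 < x + b.
  have : - b < x by near: x; exact: near_pinfty_gt.
  by rewrite -subr_gt0 opprK addrC.
by rewrite /locd; field; rewrite !gt_eqF ?mulr_gt0.
Unshelve. all: by end_near. Qed.

Lemma F_incr c d : c < d -> (F (y + c) - F (y + d)) / q y @[y --> +oo] --> d - c.
Proof.
move=> cd; have dc : 0 < d - c by rewrite subr_gt0.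
have : (F (y + c) - F (y + c + (d - c))) / q (y + c) * (q (y + c) / q y) @[y --> +oo] --> (d - c) * 1.
  apply: cvgM; last exact: locd_shift.
  exact: (cvg_shift (fun y => (F y - F (y + (d - c))) / q y) (d - c) c (F_loc _ dc)).
rewrite mulr1; apply: cvg_trans; apply: near_eq_cvg; near=> y.
have y0 : 0 < y by near: y; exact: near_pinfty_gt.
have yc : 0 < y + c.
  have : - c < y by near: y; exact: near_pinfty_gt.
  by rewrite -subr_gt0 opprK addrC.
have -> : y + c + (d - c) = y + d by ring.
rewrite mulrA mulfVK// gt_eqF// locd_gt0//.
Unshelve. all: by end_near. Qed.

(* The slack [e] absorbs an atom of the law at an end point of the interval. *)
Lemma squeeze_F_incr (h : R -> R) (c d : R) : c < d ->
  (forall e, 0 < e -> e < d - c -> \forall y \near +oo,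
    F (y + c) - F (y + (d - e)) <= h y <= F (y + (c - e)) - F (y + d)) ->
  h y / q y @[y --> +oo] --> d - c.
Proof.
move=> cd hh; apply/cvgrPdist_le => e e0.
pose e' := Num.min (e / 2) ((d - c) / 2).
have dc : 0 < d - c by rewrite subr_gt0.
have e'0 : 0 < e' by rewrite lt_min !divr_gt0.
have e'e : e' <= e / 2 by rewrite ge_min lexx.
have e'd : e' <= (d - c) / 2 by rewrite ge_min lexx orbT.
have e2 : 0 < e / 2 by rewrite divr_gt0.
have h1 : c < d - e' by lra.
have h2 : c - e' < d by lra.
have H := hh e' e'0 _.
have L1 := cvgr_ge _ (F_incr _ _ h1) (d - c - e).
have L2 := cvgr_le _ (F_incr _ _ h2) (d - c + e).
near=> y.
have y0 : 0 < y by near: y; exact: near_pinfty_gt.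
have /andP[H1 H2] : F (y + c) - F (y + (d - e')) <= h y <= F (y + (c - e')) - F (y + d).
  by near: y; apply: H; lra.
have q0 := locd_gt0 _ y0.
have M1 : d - c - e <= (F (y + c) - F (y + (d - e'))) / q y.
  by near: y; apply: L1; rewrite ltrBlDr; lra.
have M2 : (F (y + (c - e')) - F (y + d)) / q y <= d - c + e.
  by near: y; apply: L2; lra.
rewrite ler_distlC; apply/andP; split.
  by apply: (le_trans M1); rewrite ler_pM2r ?invr_gt0.
by apply: le_trans M2; rewrite ler_pM2r ?invr_gt0.
Unshelve. all: by end_near. Qed.

End local_asymptotics.

(** * The function [g] and the recursion satisfied by its integrals *)

Section exponential_functional.
Context {R : realType}.

Definition gexp (lambda b x : R) : R :=
  expR (- (lambda * (b * x))) * \1_[set x | 0 <= b * x] x.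

Variables (lambda b : R).
Hypothesis lambda_gt0 : 0 < lambda.
Hypothesis bb : b * b = 1.
Local Notation g := (gexp lambda b).

Lemma measurable_ge_set (z : R) : measurable [set u : R | z <= b * u].
Proof.
rewrite (_ : [set _ | _] = [set u : R | - b * u <= - z]); first exact: measurable_le_set.
by apply/seteqP; split => u /=; rewrite mulNr lerN2.
Qed.

Lemma measurable_gexp : measurable_fun setT g.
Proof.
apply: measurable_funM; last by apply: measurable_indic; exact: measurable_ge_set.
apply: measurableT_comp => //; apply: measurableT_comp => //.
by do 2 apply: measurable_funM => //.
Qed.

Lemma gexpE x : g x = if 0 <= b * x then expR (- (lambda * (b * x))) else 0.
Proof.
rewrite /gexp indicE; case: ifPn => h; first by rewrite mem_set// mulr1.
by rewrite memNset ?mulr0//; exact/negP.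
Qed.

Lemma gexp_ge0 x : 0 <= g x.
Proof. by rewrite gexpE; case: ifP => // _; rewrite expR_ge0. Qed.

Lemma gexp_le1 x : g x <= 1.
Proof.
rewrite gexpE; case: ifP => // h.
by rewrite -[leRHS]expR0 ler_expR oppr_le0 mulr_ge0// ltW.
Qed.

Lemma norm_b : `|b| = 1.
Proof.
have : `|b| ^+ 2 = 1 by rewrite -normrX expr2 bb normr1.
by move/eqP; rewrite sqrp_eq1// => /eqP.
Qed.

(** On the support [b * x] is the modulus of [x], so [g] decays at rate [lambda] in that modulus and
    lies below [expR (s * x)] whatever the sign of [x]. The same Chernoff bound thus serves both
    values of [b]. *)
Lemma gexp_le_expR s x : 0 <= s <= lambda -> g x <= expR (s * x).
Proof.
move=> /andP[s0 sl]; rewrite gexpE; case: ifP => h; last exact: expR_ge0.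
rewrite ler_expR lerNl -mulrN.
have h1 : - x <= b * x by rewrite -[b * x]ger0_norm// normrM norm_b mul1r -normrN ler_norm.
by rewrite (@le_trans _ _ (s * (b * x)))// ?ler_wpM2l// ler_wpM2r.
Qed.

(** The shift [b * N] compensates the worst displacement [u], so a point of the support stays in it,
    and the exponent changes by at most [2 * lambda * N]. *)
Lemma gexp_shift_le (N x u : R) : `|u| <= N -> g x <= expR (2 * lambda * N) * g (x + u + b * N).
Proof.
move=> uN; have bu : - N <= b * u <= N by rewrite -ler_norml normrM norm_b mul1r.
have E : b * (x + u + b * N) = b * x + (b * u + N) by rewrite !mulrDr mulrA bb; ring.
rewrite !gexpE E; case: ifP => h; last first.
  by rewrite mulr_ge0 ?expR_ge0//; case: ifP => // _; rewrite expR_ge0.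
rewrite ifT; last by lra.
rewrite -expRD ler_expR.
have : lambda * (b * u + N) <= lambda * (2 * N) by rewrite ler_pM2l//; lra.
by rewrite !mulrDr; lra.
Qed.

Variables (mu : probability R R) (dl : R).
Hypothesis dl_gt0 : 0 < dl.
Local Notation theta := (expR (- (lambda * dl))).

(** This is [[y, y + dl[] for [b = 1] and []y - dl, y]] for [b = -1]: the slice that the support of
    [g (u - y)] loses when [y] becomes [y + b * dl]. *)
Definition cell (y : R) : set R := [set u | 0 <= b * (u - y) < dl].

Lemma measurable_cell y : measurable (cell y).
Proof.
rewrite (_ : cell y = [set u | b * y <= b * u] `&` ~` [set u | b * y + dl <= b * u]).
  by apply: measurableI; [|apply: measurableC]; exact: measurable_ge_set.
apply/seteqP; split => u; rewrite /cell/= mulrBr subr_ge0 ltrBlDl.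
  by move=> /andP[-> h]; split => //; apply/negP; rewrite -ltNge.
by move=> [-> /negP]; rewrite -ltNge.
Qed.

(** Beyond the cell, the shift divides out exactly the factor [theta]. On the cell the shifted
    function is 0 and [g (u - y)] lies between [theta] and 1. Elsewhere both vanish. *)
Lemma gexp_rec u y : theta * (g (u - (y + b * dl)) + \1_(cell y) u) <= g (u - y) <=
  theta * g (u - (y + b * dl)) + \1_(cell y) u.
Proof.
set v := b * (u - y).
have E : b * (u - (y + b * dl)) = v - dl by rewrite /v !mulrBr mulrDr mulrA bb; ring.
rewrite !gexpE E -/v indicE.
have t1 : theta <= 1 by rewrite -[leRHS]expR0 ler_expR oppr_le0 mulr_ge0// ltW.
have [v0|v0] := leP 0 v; last first.
  rewrite subr_ge0 (lt_geF (lt_trans v0 dl_gt0)).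
  rewrite memNset; first by rewrite mulr0n addr0 mulr0 addr0 lexx.
  by rewrite /cell/= -/v => /andP[]; rewrite leNgt v0.
have [vd|vd] := ltP v dl.
  rewrite subr_ge0 (lt_geF vd).
  rewrite mem_set; last by rewrite /cell/= -/v v0.
  rewrite mulr1n mulr0 !add0r mulr1; apply/andP; split.
    by rewrite ler_expR lerN2 ler_pM2l// ltW.
  by rewrite -[leRHS]expR0 ler_expR oppr_le0 mulr_ge0// ltW.
rewrite subr_ge0 vd memNset; last first.
  by rewrite /cell/= -/v => /andP[_]; rewrite ltNge vd.
rewrite mulr0n !addr0 -expRD (_ : - (lambda * dl) + - (lambda * (v - dl)) = - (lambda * v)) ?lexx//.
by ring.
Qed.

Definition gint (D : set R) (y : R) : R := \int[mu]_(u in D) g (u - y).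

Lemma bounded_integrable (D : set R) (f : R -> R) (M : R) : measurable D ->
  measurable_fun setT f -> (forall x, `|f x| <= M) -> mu.-integrable D (EFin \o f).
Proof.
move=> mD mf fM; apply: measurable_bounded_integrable => //.
- by rewrite (le_lt_trans (probability_le1 _ _))// ltry.
- exact: measurable_funS mf.
- by exists M; split; [exact: num_real|move=> c c1 u _ /=; rewrite (le_trans (fM _))// ltW].
Qed.

Lemma measurable_gexp_shift (y : R) : measurable_fun setT (fun u : R => g (u - y)).
Proof. by apply: (measurableT_comp measurable_gexp); exact: measurable_funB. Qed.

Lemma integrable_gexp (D : set R) (y : R) : measurable D -> mu.-integrable D (EFin \o (fun u : R => g (u - y))).
Proof.
move=> mD; apply: (bounded_integrable _ _ 1) => //; first exact: measurable_gexp_shift.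
by move=> x; rewrite ger0_norm ?gexp_ge0// gexp_le1.
Qed.

Lemma gint_ge0 D y : 0 <= gint D y.
Proof. by apply: Rintegral_ge0 => u _; exact: gexp_ge0. Qed.

Lemma Rintegral_cst_le D (k : R) : measurable D -> 0 <= k -> \int[mu]_(u in D) k <= k.
Proof.
move=> mD k0; rewrite Rintegral_cst// -[leRHS]mulr1 ler_wpM2l//.
by rewrite -lee_fin fineK ?fin_num_measure// probability_le1.
Qed.

Lemma gint_le1 D y : measurable D -> gint D y <= 1.
Proof.
move=> mD; apply: le_trans (Rintegral_cst_le D 1 mD ler01); apply: le_Rintegral => //.
- exact: integrable_gexp.
- exact: finite_measure_integrable_cst.
- by move=> u _; exact: gexp_le1.
Qed.

Lemma Rintegral_indic (D E : set R) : measurable D -> measurable E ->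
  \int[mu]_(u in D) \1_E u = fine (mu (E `&` D)).
Proof. by move=> mD mE; rewrite /Rintegral integral_indic. Qed.

Lemma gint_rec D (y : R) : measurable D ->
  theta * (gint D (y + b * dl) + fine (mu (cell y `&` D))) <= gint D y <=
  theta * gint D (y + b * dl) + fine (mu (cell y `&` D)).
Proof.
move=> mD; have mc := measurable_cell y.
have i1 := integrable_gexp D (y + b * dl) mD.
have i2 : mu.-integrable D (EFin \o \1_(cell y)).
  apply: (bounded_integrable _ _ 1) => //.
  by move=> x; rewrite ger0_norm// indicE lern1 leq_b1.
have i3 : mu.-integrable D (EFin \o (fun u : R => g (u - (y + b * dl)) + \1_(cell y) u)).
  exact: (integrableD mD i1 i2).
have i4 : mu.-integrable D (EFin \o (fun u : R => theta * g (u - (y + b * dl)))).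
  exact: (integrableZl mD theta i1).
have i5 := integrable_gexp D y mD.
rewrite -Rintegral_indic// /gint -RintegralD// -RintegralZl// -[X in _ && (_ <= X + _)]RintegralZl//.
rewrite -RintegralD//; apply/andP; split; apply: le_Rintegral => //.
- exact: (integrableZl mD theta i3).
- by move=> u _; have /andP[] := gexp_rec u y.
- exact: (integrableD mD i4 i2).
- by move=> u _; have /andP[] := gexp_rec u y.
Qed.

End exponential_functional.

Lemma oneB_expRN {R : realType} (x : R) : 0 < x ->
  [/\ 0 < 1 - expR (- x), 1 - expR (- x) <= x & x <= (1 - expR (- x)) * (1 + x)].
Proof.
move=> x0; have e0 := expR_gt0 (- x); split.
- by rewrite subr_gt0 -[ltRHS]expR0 ltr_expR oppr_lt0.
- by have := expR_ge1Dx (- x); lra.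
- have h : expR (- x) * (1 + x) <= 1.
    apply: (@le_trans _ _ (expR (- x) * expR x)); last by rewrite mulrC expRxMexpNx_1.
    by rewrite ler_pM2l// expR_ge1Dx.
  by rewrite mulrBl; lra.
Qed.

(* [lambda^-1] is, up to [O(lambda * dl ^ 2)], the fixed point of
   [h = th * h + dl] with [th = exp (- lambda * dl)]. *)
Lemma perturbed_fixpoint {R : realType} (lambda dl rho d h h' ka ep : R) :
  0 < lambda -> 0 < dl -> 0 < ka -> ka <= lambda * dl -> ka < 1 ->
  lambda * dl <= ka * (1 + lambda * dl) -> lambda * dl <= 1 ->
  ep = lambda * dl ^+ 2 ->
  0 <= d -> 0 <= rho -> `|1 - rho| <= Num.min (ka / 2) (lambda * ep) -> `|dl - d| <= ep ->
  (1 - ka) * (h' * rho + d) <= h <= (1 - ka) * (h' * rho) + d ->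
  `|h - lambda^-1| <= (1 - ka / 2) * `|h' - lambda^-1| + 4 * ep.
Proof.
move=> l0 dl0 ka0 ka_le ka1 ka_ge ll1 epE d0 rho0.
rewrite le_min => /andP[Ha Hb] Hd /andP[G1 G2].
rewrite ler_distl in Ha; rewrite ler_distl in Hb; rewrite ler_distl in Hd.
move: Ha Hb Hd => /andP[r1 r2] /andP[r3 r4] /andP[d1 d2].
have ep0 : 0 < ep by rewrite epE mulr_gt0// exprn_gt0.
pose th := 1 - ka; have th0 : 0 < th by rewrite subr_gt0.
have th1 : th <= 1 by rewrite /th gerBl ltW.
have tr0 : 0 <= th * rho by rewrite mulr_ge0// ltW.
have tr1 : th * rho <= 1 - ka / 2.
  have h1 : th * (rho - 1) <= ka / 2.
    rewrite (@le_trans _ _ (th * (ka / 2)))//; first by rewrite ler_pM2l//; clear - r1; lra.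
    by rewrite ler_piMl// divr_ge0// ltW.
  by move: h1; rewrite mulrBr mulr1 /th; clear; lra.
have A2 : 0 <= dl - ka / lambda <= ep.
  rewrite subr_ge0 ler_pdivrMr// (mulrC dl) ka_le/= lerBlDr -lerBlDl ler_pdivlMr//.
  have h1 : ka * (lambda * dl) <= lambda * dl * (lambda * dl) by rewrite ler_pM2r// mulr_gt0.
  have -> : (dl - ep) * lambda = lambda * dl - lambda * dl * (lambda * dl) by rewrite epE; ring.
  by move: ka_ge; rewrite mulrDr mulr1; clear - h1; lra.
have A3 : `|th * (rho - 1) / lambda| <= ep.
  rewrite normrM normfV (gtr0_norm l0) ler_pdivrMr// normrM (gtr0_norm th0).
  rewrite (@le_trans _ _ (1 * (lambda * ep)))//; last by rewrite mul1r mulrC.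
  rewrite ler_pM ?(ltW th0)//.
  by rewrite ler_distl; apply/andP; split; clear - r3 r4; lra.
have kd : 0 <= ka * d <= 2 * ep.
  rewrite mulr_ge0 ?(ltW ka0)//=.
  have h1 : ka * d <= ka * (dl + ep) by rewrite ler_pM2l//; clear - d1; lra.
  have h2 : ka * dl <= ep by rewrite epE expr2 mulrA ler_pM2r.
  have h3 : ka * ep <= ep by rewrite ler_piMl ?(ltW ep0) ?(ltW ka1).
  by move: h1; rewrite mulrDr; clear - h2 h3; lra.
have main : `|h - lambda^-1 - th * rho * (h' - lambda^-1)| <= 4 * ep.
  move: A3; rewrite ler_norml => /andP[A3 A4]; move: A2 kd => /andP[A2 A2'] /andP[k0 k1].
  (* Three errors: the first lies between [- 3 * ep] and [ep] (by [kd] and the bounds on [d]), the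
     second is at most [ep] in modulus, the third lies between 0 and [ep]. *)
  have -> : h - lambda^-1 - th * rho * (h' - lambda^-1) =
      (h - th * rho * h' - dl) + th * (rho - 1) / lambda + (dl - ka / lambda).
    by rewrite /th; field; rewrite gt_eqF.
  have B1 : th * rho * h' + d - ka * d <= h.
    by apply: le_trans G1; rewrite le_eqVlt; apply/orP; left; apply/eqP; rewrite /th; ring.
  have B2 : h <= th * rho * h' + d.
    by apply: (le_trans G2); rewrite le_eqVlt; apply/orP; left; apply/eqP; rewrite /th; ring.
  rewrite ler_norml; move: A3 A4 A2 A2' k0 k1 B1 B2 d1 d2; clear - ep0.
  by move=> *; apply/andP; split; lra.
have -> : h - lambda^-1 = th * rho * (h' - lambda^-1) +
    (h - lambda^-1 - th * rho * (h' - lambda^-1)) by rewrite [RHS]addrC subrK.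
rewrite (le_trans (ler_normD _ _))// lerD// normrM (ger0_norm tr0).
by rewrite ler_wpM2r.
Qed.

(** * Uniform bounds and asymptotics of [G] *)

Section gexp_asymptotics.
Context {R : realType}.
Variables (mu : probability R R) (alpha lambda b : R).

Definition tailF (x : R) : R := fine (mu `]x, +oo[%classic).

Lemma tailF_ge0 x : 0 <= tailF x.
Proof. by rewrite fine_ge0. Qed.

Lemma tailF_ni x y : x <= y -> tailF y <= tailF x.
Proof.
move=> xy; rewrite fine_le ?fin_num_measure ?le_measure ?inE//; try exact: measurable_itv.
by move=> u /=; rewrite !in_itv/= !andbT; exact: le_lt_trans.
Qed.

Lemma tailF_itv x y : x <= y -> fine (mu `]x, y]%classic) = tailF x - tailF y.
Proof.
move=> xy; rewrite /tailF [X in fine X - _](_ : _ = mu (`]x, y]%classic `|` `]y, +oo[%classic)); last first.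
  congr (mu _); apply/seteqP; split => u /=; rewrite !in_itv/= !andbT.
    by move=> xu; have [uy|uy] := leP u y; [left; rewrite xu|right].
  by move=> [/andP[]//|]; exact: le_lt_trans.
rewrite measureU//; try exact: measurable_itv; last first.
  apply/seteqP; split => u //=; rewrite !in_itv/= !andbT => -[/andP[_]].
  by rewrite leNgt => /negP.
rewrite fineD ?fin_num_measure//; try exact: measurable_itv.
by rewrite addrK.
Qed.

Local Notation F := tailF.
Local Notation q := (locd F alpha).
Hypothesis alpha_gt0 : 0 < alpha.
Hypothesis F_gt0 : forall x, 0 < F x.
Hypothesis F_scale : forall k, 0 < k -> F (k * x) / F x @[x --> +oo] --> k `^ (- alpha).
Hypothesis F_loc : forall e, 0 < e -> (F y - F (y + e)) / q y @[y --> +oo] --> e.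
Hypothesis lambda_gt0 : 0 < lambda.
Hypothesis bb : b * b = 1.

Let le_fine_mu (A B : set R) : measurable A -> measurable B -> A `<=` B -> fine (mu A) <= fine (mu B).
Proof. by move=> mA mB AB; rewrite fine_le ?fin_num_measure ?le_measure ?inE. Qed.

Let b_cases : b = 1 \/ b = -1.
Proof.
have : b ^+ 2 == 1 by rewrite expr2 bb.
by rewrite sqrf_eq1 => /orP[] /eqP; [left|right].
Qed.

Lemma cell_cvg dl : 0 < dl -> fine (mu (cell b dl y)) / q y @[y --> +oo] --> dl.
Proof.
move=> dl0; have mc y := measurable_cell b dl y.
have mI (u v : R) : measurable `]u, v]%classic by exact: measurable_itv.
have sq := squeeze_F_incr F alpha alpha_gt0 F_gt0 F_loc.
have [b1|b1] := b_cases.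
  rewrite -[X in _ --> X]subr0; apply: sq => // e e0 ed; apply: nearW => y.
  rewrite -!tailF_itv ?lerD2l//; last 2 first.
  - by lra.
  - by rewrite subr0 in ed; lra.
  apply/andP; split; apply: le_fine_mu => // u; rewrite /cell/= b1 mul1r in_itv/=.
    by move=> /andP[h1 h2]; apply/andP; split; lra.
  by move=> /andP[h1 h2]; apply/andP; split; lra.
rewrite -[X in _ --> X]add0r -[X in _ + X]opprK; apply: sq => [|e e0 ed]; first by rewrite oppr_lt0.
apply: nearW => y; rewrite -!tailF_itv ?lerD2l//; last 2 first.
- by lra.
- by lra.
apply/andP; split; apply: le_fine_mu => // u; rewrite /cell/= b1 mulN1r in_itv/=.
  by move=> /andP[h1 h2]; apply/andP; split; lra.
by move=> /andP[h1 h2]; apply/andP; split; lra.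
Qed.

(** The recursion with unit cells, restricted to jumps above [z]: every cell meets []z, +oo[] in
    mass at most [3 * q (z - 1)], and the contraction passes this bound on to the integral.
    Uniformity in [y] makes it usable wherever the rest of the path lies. *)
Lemma gint_tail_le : exists C z0, [/\ 0 < C, 1 < z0 & forall z y, z0 <= z ->
  gint lambda b mu `]z, +oo[%classic y <= C * q (z - 1)].
Proof.
have mI (u v : R) : measurable `]u, v]%classic by exact: measurable_itv.
have mO (u : R) : measurable `]u, +oo[%classic by exact: measurable_itv.
have t1 : expR (- (lambda * 1)) < 1 by rewrite -[ltRHS]expR0 ltr_expR oppr_lt0 mulr_gt0.
have t1' : 0 < 1 - expR (- (lambda * 1)) by rewrite subr_gt0.
(* The limit is 2, the length of the interval; 3 is a convenient larger constant. *)
have [M [_ hM]] : \forall y \near +oo, (F y - F (y + 2)) / q y < 3.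
  by apply: (cvgr_lt _ (F_loc _ (ltr0n _ 2))); rewrite ltr_nat.
pose z0 := Num.max (M + 2) 2.
exists (3 / (1 - expR (- (lambda * 1)))), z0; split; first by rewrite divr_gt0.
  by rewrite lt_max ltr1n orbT.
move=> z y; rewrite ge_max => /andP[zM z2].
rewrite mulrAC; apply: (contraction_bound (gint lambda b mu `]z, +oo[%classic) 1 _ _ (b * 1)).
- by rewrite expR_ge0.
- by rewrite mulr_ge0// ltW// locd_gt0//; lra.
- by move=> {}y; exact: gint_le1.
move=> {}y; have /andP[_] := gint_rec lambda b lambda_gt0 bb mu 1 ltr01 `]z, +oo[%classic y (mO z).
move=> /le_trans; apply; rewrite lerD2l//.
(* For either orientation []w, w + 2]] contains the part of the cell above [z], and [w >= z - 1]
   allows the monotonicity of [q]. *)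
pose w := Num.max (z - 1) (y - 1).
have wz : z - 1 <= w by rewrite le_max lexx.
have wy : y - 1 <= w by rewrite le_max lexx orbT.
have w0 : 0 < w by lra.
apply: (@le_trans _ _ (fine (mu `]w, w + 2]%classic))).
  apply: le_fine_mu => //; first by apply: measurableI => //; exact: measurable_cell.
  move=> u; rewrite /cell/= !in_itv/= andbT => -[h zu].
  rewrite gt_max; have [b1|b1] := b_cases; move: h; rewrite b1 => /andP[h1 h2];
    by apply/andP; split; [apply/andP; split|]; lra.
rewrite tailF_itv ?lerDl//; apply: (@le_trans _ _ (3 * q w)).
  by rewrite -ler_pdivrMr ?locd_gt0// ltW// hM//; lra.
by rewrite ler_pM2l// locd_ni// ?tailF_ni//; [exact: tailF_ni|lra].
Qed.

(** A point [u <= z] is at distance at least [y - z] from [y], so there [g (u - y)] is at most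
    [expR (- (lambda * (y - z)))]. *)
Lemma gint_le_tail z y : z <= y ->
  gint lambda b mu setT y <= gint lambda b mu `]z, +oo[%classic y + expR (- (lambda * (y - z))).
Proof.
move=> zy; have mO : measurable `]z, +oo[%classic by exact: measurable_itv.
rewrite /gint -[in leLHS](setUv `]z, +oo[%classic) Rintegral_setU//.
- rewrite lerD2l// (le_trans _ (Rintegral_cst_le mu (~` `]z, +oo[%classic) _ _ (expR_ge0 _)))//; last exact: measurableC.
  have mC : measurable (~` `]z, +oo[%classic) by exact: measurableC.
  apply: le_Rintegral => //; first exact: integrable_gexp.
    exact: finite_measure_integrable_cst.
  move=> u /=; rewrite in_itv/= andbT => /negP; rewrite -leNgt => uz.
  have ll : 0 <= lambda <= lambda by rewrite lexx ltW.
  rewrite (le_trans (gexp_le_expR lambda b bb lambda _ ll))//.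
  by rewrite ler_expR -mulrN ler_pM2l//; lra.
- exact: measurableC.
- by rewrite setUv; exact: integrable_gexp.
- by rewrite disj_set2E setICr.
Qed.

Hypothesis F_low : \forall x \near +oo, x `^ (- (alpha + 1)) <= F x.

(** In the exponent [alpha + 2], the lower bound on [F] accounts for [alpha + 1] and the factor
    [alpha / y] of [q] for 1; the strict inequality absorbs the constants. *)
Lemma near_powR_le_locd (e g : R) : 0 < e -> alpha + 2 < g -> \forall y \near +oo, y `^ (- g) <= e * q y.
Proof.
move=> e0 ag; have h0 : 0 < g - (alpha + 2) by rewrite subr_gt0.
near=> y.
have y0 : 0 < y by near: y; exact: near_pinfty_gt.
have h1 : (e * alpha)^-1 <= y `^ (g - (alpha + 2)) by near: y; exact: near_le_powR.
have h2 : y `^ (- (alpha + 1)) <= F y by near: y.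
have -> : - g = - (g - (alpha + 2)) - 1 - (alpha + 1) by ring.
rewrite powRB ?(gt_eqF y0) ?implybT// powRB ?(gt_eqF y0) ?implybT// powRr1 ?(ltW y0)//.
have p0 := powR_gt0 (alpha + 1) y0.
have p1 : (y `^ (g - (alpha + 2)))^-1 <= e * alpha.
  by rewrite -[leRHS]invrK lef_pV2// posrE ?powR_gt0// invr_gt0 mulr_gt0.
rewrite !powRN in h2 *; rewrite (_ : e * q y = e * alpha / y * F y); last first.
  by rewrite /locd !mulrA.
apply: ler_pM => //; first by rewrite !mulr_ge0// invr_ge0 ?powR_ge0 ?(ltW y0).
  by rewrite invr_ge0 powR_ge0.
by rewrite ler_pM2r ?invr_gt0.
Unshelve. all: by end_near. Qed.

Lemma near_expR_le_locd (c e : R) : 0 < c -> 0 < e ->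
  \forall y \near +oo, expR (- (c * y)) <= e * q y.
Proof.
move=> c0 e0; have H := near_powR_le_locd e (alpha + 3) e0.
near=> y; apply: (@le_trans _ _ (y `^ (- (alpha + 3)))).
  by near: y; exact: near_expR_le_powR.
by near: y; apply: H; lra.
Unshelve. all: by end_near. Qed.

(** The a priori bound required by the contraction. Cutting at [y / 2] leaves an exponentially small
    remainder, and [y / 2 - 1 >= y / 3] reduces the rest to the ratio of [q (y / 3)] to [q y]. *)
Let gint_bounded : exists M Y, forall y, Y <= y -> gint lambda b mu setT y / q y <= M.
Proof.
have [C [z0 [C0 z01 hC]]] := gint_tail_le.
have l2 : 0 < lambda / 2 by rewrite divr_gt0.
have [k0 k1] : 0 < 3^-1 :> R /\ 3^-1 < 1 :> R by split; lra.
have S := locd_scale F alpha alpha_gt0 F_gt0 F_scale _ k0.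
pose S1 := 3^-1^-1 * 3^-1 `^ (- alpha) + 1.
have H1 := cvgr_le _ S S1.
have H2 := near_expR_le_locd _ _ l2 (@ltr01 R).
have : \forall y \near +oo, gint lambda b mu setT y / q y <= C * S1 + 1.
  near=> y.
  have y12 : 12 + 2 * z0 <= y by near: y; exact: near_pinfty_ge.
  have q0 : 0 < q y by apply: locd_gt0 => //; lra.
  rewrite ler_pdivrMr//.
  have y2 : y / 2 <= y by lra.
  rewrite (le_trans (gint_le_tail _ _ y2))// mulrDl mul1r lerD//.
    have hz : z0 <= y / 2 by lra.
    rewrite (le_trans (hC _ y hz))// -mulrA ler_pM2l//.
    have s1 : q (3^-1 * y) / q y <= S1 by near: y; apply: H1; rewrite /S1; lra.
    rewrite ler_pdivrMr// in s1; apply: le_trans s1.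
    by apply: locd_ni => //; [exact: tailF_ni|lra|lra].
  have -> : lambda * (y - y / 2) = lambda / 2 * y by field.
  by rewrite -[leRHS]mul1r; near: y.
move=> [M [_ hM]]; exists (C * S1 + 1), (M + 1) => y My; apply: hM; lra.
Unshelve. all: by end_near. Qed.

Lemma gint_cvg : gint lambda b mu setT y / q y @[y --> +oo] --> lambda^-1.
Proof.
have [M [Y hM]] := gint_bounded.
apply/cvgrPdist_le => e e0.
(* The contraction leaves the residue [4 * ep / (ka / 2)]. As [lambda * dl <= 1] gives
   [ep <= 2 * ka * dl], it is at most [16 * dl <= e / 2]. *)
pose dl := Num.min (e / 32) (lambda^-1).
have dl0 : 0 < dl by rewrite lt_min divr_gt0 ?invr_gt0.
have dle : dl <= e / 32 by rewrite ge_min lexx.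
have dll : lambda * dl <= 1.
  by rewrite mulrC -ler_pdivlMr// div1r ge_min lexx orbT.
have ld0 : 0 < lambda * dl by rewrite mulr_gt0.
pose ka := 1 - expR (- (lambda * dl)).
have [ka0 ka_le ka_ge] : [/\ 0 < ka, ka <= lambda * dl & lambda * dl <= ka * (1 + lambda * dl)].
  exact: oneB_expRN.
have ka1 : ka < 1 by rewrite /ka gtrBl expR_gt0.
pose rho y := q (y + b * dl) / q y.
pose dd y := fine (mu (cell b dl y)) / q y.
pose h y := gint lambda b mu setT y / q y.
pose v y := `|h y - lambda^-1|.
have rho1 : rho y @[y --> +oo] --> (1 : R) by exact: (locd_shift F alpha alpha_gt0 F_gt0 F_loc).
have dd1 : dd y @[y --> +oo] --> dl by exact: cell_cvg.
pose ep := lambda * dl ^+ 2.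
have ep0 : 0 < ep by rewrite mulr_gt0// exprn_gt0.
pose r := 1 - ka / 2.
have r01 : 0 <= r < 1 by rewrite /r; apply/andP; split; lra.
pose e1 := Num.min (ka / 2) (lambda * ep).
have e1_gt0 : 0 < e1 by rewrite lt_min divr_gt0//= mulr_gt0.
have e1k : e1 <= ka / 2 by rewrite ge_min lexx.
have e1l : e1 <= lambda * ep by rewrite ge_min lexx orbT.
have /cvgrPdist_le/(_ e1 e1_gt0) H1 := rho1.
have /cvgrPdist_le/(_ ep ep0) H2 := dd1.
have [Y2 [_ H3]] : \forall y \near +oo, [/\ 0 < y, 0 < y + b * dl,
    `|1 - rho y| <= e1 & `|dl - dd y| <= ep].
  near=> y.
  have yb : - (b * dl) < y by near: y; exact: near_pinfty_gt.
  split; [by near: y; exact: near_pinfty_gt| |by near: y; exact: H1|by near: y; exact: H2].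
  by move: yb; rewrite -subr_gt0 opprK.
pose Y' := Num.max Y (Y2 + 1).
have vM y : Y' <= y -> v y <= M + lambda^-1.
  rewrite ge_max => /andP[Yy Y2y].
  have [y0 _ _ _] : [/\ 0 < y, 0 < y + b * dl, `|1 - rho y| <= e1 & `|dl - dd y| <= ep].
    by apply: H3; lra.
  have h0 : 0 <= h y by rewrite divr_ge0 ?gint_ge0 ?ltW// locd_gt0.
  have hM' := hM y Yy; rewrite -/(h y) in hM'.
  have li : 0 < lambda^-1 by rewrite invr_gt0.
  by rewrite /v ler_norml; apply/andP; split; lra.
have vr y : Y' <= y -> v y <= r * v (y + b * dl) + 4 * ep.
  rewrite ge_max => /andP[Yy Y2y].
  have [y0 yb] : [/\ 0 < y, 0 < y + b * dl, `|1 - rho y| <= e1 & `|dl - dd y| <= ep].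
    by apply: H3; lra.
  move=> Hrho Hdd.
  have q0 := locd_gt0 F alpha alpha_gt0 F_gt0 _ y0.
  have qb := locd_gt0 F alpha alpha_gt0 F_gt0 _ yb.
  have /andP[G1 G2] := gint_rec lambda b lambda_gt0 bb mu dl dl0 setT y measurableT.
  rewrite setIT -[expR _](subKr 1) -/ka in G1 G2.
  have E1 : h (y + b * dl) * rho y = gint lambda b mu setT (y + b * dl) / q y.
    by rewrite /h /rho mulrA mulfVK// gt_eqF.
  apply: (perturbed_fixpoint lambda dl (rho y) (dd y)) => //.
  - by apply: divr_ge0; [exact: fine_ge0|exact: ltW].
  - by apply: divr_ge0; exact: ltW.
  - rewrite E1 /h /dd -mulrDl !mulrA -mulrDl !ler_pM2r ?invr_gt0// G1.
    exact: G2.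
have ee : 4 * ep / (1 - r) + e / 2 <= e.
  have -> : 1 - r = ka / 2 by rewrite /r; ring.
  suff : 4 * ep / (ka / 2) <= e / 2 by lra.
  rewrite ler_pdivrMr ?divr_gt0//.
  have h1 : lambda * dl <= 2 * ka.
    rewrite (le_trans ka_ge)// mulrC ler_pM2r//; lra.
  have h2 : ep <= 2 * ka * dl by rewrite /ep expr2 mulrA ler_pM2r.
  have h3 : ka * dl <= ka * (e / 32) by rewrite ler_pM2l.
  by lra.
have e20 : 0 < e / 2 by rewrite divr_gt0.
have ep4 : 0 <= 4 * ep by rewrite mulr_ge0// ltW.
have := contraction_pinfty v Y' (M + lambda^-1) r (4 * ep) (b * dl) (e / 2) r01 ep4 vM vr e20.
by apply: filterS => y vy; rewrite distrC -/(v y) (le_trans vy).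
Unshelve. all: by end_near. Qed.

End gexp_asymptotics.

(** * The big jump *)

Section truncated_walk.
Context {R : realType}.
Variables (mu : probability R R) (a alpha beta lambda : R).
Hypothesis mu_int : mu.-integrable setT (EFin : R -> \bar R).
Hypothesis mu_mean : (\int[mu]_u u%:E = (- a)%:E)%E.
Hypothesis a_gt0 : 0 < a.
Hypothesis alpha_gt1 : 1 < alpha.
Hypothesis beta_gt1 : 1 < beta.
Hypothesis lambda_gt0 : 0 < lambda.
Local Notation F := (tailF mu).
Local Notation q := (locd F alpha).
Hypothesis F_up : \forall x \near +oo, F x <= x `^ (- beta).
Hypothesis F_low : \forall x \near +oo, x `^ (- (alpha + 1)) <= F x.

Let alpha_gt0 : 0 < alpha. Proof. exact: lt_trans alpha_gt1. Qed.

Lemma near_powR_le_locd_scale (e g : R) : 0 < e -> alpha + 2 < g ->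
  \forall t \near +oo, t `^ (- g) <= e * q (a * t).
Proof.
move=> e0 ag; have ap : 0 < a `^ (- g) by exact: powR_gt0.
have H := near_affine _ _ 0 a_gt0 (near_powR_le_locd mu alpha alpha_gt0 F_low _ g (mulr_gt0 e0 ap) ag).
near=> t.
have t0 : 0 < t by near: t; exact: near_pinfty_gt.
have : (a * t) `^ (- g) <= e * a `^ (- g) * q (a * t).
  by rewrite -[a * t]addr0; near: t.
by rewrite powRM ?(ltW a_gt0) ?(ltW t0)// mulrAC [leRHS]mulrC ler_pM2l.
Unshelve. all: by end_near. Qed.

Lemma near_expR_le_locd_scale (c e : R) : 0 < c -> 0 < e ->
  \forall t \near +oo, expR (- (c * t)) <= e * q (a * t).
Proof.
move=> c0 e0; have ca : 0 < c / a by rewrite divr_gt0.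
have H := near_affine _ _ 0 a_gt0 (near_expR_le_locd mu alpha alpha_gt0 F_low _ _ ca e0).
near=> t.
have -> : c * t = c / a * (a * t) by field; rewrite gt_eqF.
by rewrite -[a * t]addr0; near: t.
Unshelve. all: by end_near. Qed.

(** A jump between [s^-1] and [z] contributes at most [expR (s * z)], and its probability is at most
    [F s^-1]. *)
Lemma tmgf_le_split (s z : R) : 0 < s -> tmgf mu 1 s z <= tmgf mu 1 s s^-1 + expR (s * z) * F s^-1.
Proof.
move=> s0; pose D w := [set u : R | 1 * u <= w].
have mD w : measurable (D w) by exact: measurable_le_set.
have me : measurable_fun setT (fun u : R => expR (s * (1 * u))).
  by apply: measurableT_comp => //; do 2 apply: measurable_funM => //.
have mO : measurable (`]s^-1, +oo[%classic : set R) by exact: measurable_itv.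
pose f w u := expR (s * (1 * u)) * \1_(D w) u.
have mf w : measurable_fun setT (f w) by apply: measurable_funM => //; exact: measurable_indic.
have fi w : mu.-integrable setT (EFin \o f w).
  apply: (bounded_integrable mu _ _ (expR (s * w))) => // u.
  rewrite ger0_norm ?mulr_ge0 ?expR_ge0// /f indicE.
  have [/set_mem/= uw|_] := boolP (u \in _); last by rewrite mulr0 expR_ge0.
  by rewrite mulr1 ler_expR ler_pM2l.
have E w : tmgf mu 1 s w = \int[mu]_u f w u.
  by rewrite /tmgf Rintegral_mkcond; apply: eq_Rintegral => u _; rewrite patch_indic.
have i1 : mu.-integrable setT (EFin \o (\1_(`]s^-1, +oo[%classic) : R -> R)).
  apply: (bounded_integrable mu _ _ 1) => //.
  by move=> x; rewrite ger0_norm// indicE lern1 leq_b1.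
have i2 : mu.-integrable setT (EFin \o (fun u => expR (s * z) * \1_(`]s^-1, +oo[%classic) u)).
  exact: (integrableZl measurableT (expR (s * z)) i1).
have -> : F s^-1 = \int[mu]_u \1_(`]s^-1, +oo[%classic) u by rewrite Rintegral_indic// setIT.
rewrite !E -RintegralZl// -RintegralD//.
apply: le_Rintegral => //; first exact: (integrableD measurableT (fi _) i2).
move=> u _; rewrite /f !indicE.
have [/set_mem/= h|nh] := boolP (u \in D z); last first.
  by rewrite mulr0 addr_ge0// mulr_ge0// expR_ge0.
have [us|us] := leP u s^-1.
  rewrite [u \in D s^-1]mem_set; last by rewrite /D/= mul1r.
  by rewrite mulr1 lerDl mulr_ge0// expR_ge0.
rewrite [u \in `]s^-1, +oo[%classic]mem_set; last by rewrite /= in_itv/= us.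
rewrite mulr1 mulr1 (@le_trans _ _ (expR (s * z)))//; first by rewrite ler_expR ler_pM2l.
by rewrite lerDr mulr_ge0// expR_ge0.
Qed.

Lemma near_ln_le_powR (c : R) : 0 < c -> \forall t \near +oo, c * ln t / t <= t `^ (- 2^-1).
Proof.
move=> c0; near=> t.
have t0 : 0 < t by near: t; exact: near_pinfty_gt.
have p0 := powR_gt0 4^-1 t0.
have p2 := powR_gt0 2^-1 t0.
have h : 4 * c <= t `^ 4^-1 by near: t; apply: near_le_powR; rewrite invr_gt0.
have h2 := ln_sublinear p0.
rewrite ln_powR in h2.
have E : t `^ 2^-1 = t `^ 4^-1 * t `^ 4^-1.
  rewrite -powRD ?(gt_eqF t0) ?implybT//; congr (t `^ _); lra.
have E2 : t = t `^ 2^-1 * t `^ 2^-1.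
  by rewrite -powRD ?(gt_eqF t0) ?implybT// (_ : 2^-1 + 2^-1 = 1) ?powRr1 ?(ltW t0)//; lra.
rewrite powRN ler_pdivrMr// [X in _ <= _ * X]E2 mulKf ?gt_eqF//.
rewrite E (@le_trans _ _ (4 * c * t `^ 4^-1))//; last by rewrite ler_pM2r.
by rewrite (mulrC 4) -mulrA ler_pM2l//; lra.
Unshelve. all: by end_near. Qed.

(* Chernoff's bound at [s = kap * ln t / t] for the walk with jumps truncated at
   [eps * t]: a small [eps] makes the decay a power of [t] of any order. *)
Lemma near_truncated_chernoff : exists2 eps : R, 0 < eps <= a / 4 &
  forall e : R, 0 < e -> \forall t \near +oo, exists2 s : R, 0 <= s <= lambda &
    forall n : nat, t / 2 <= n%:R ->
      tmgf mu 1 s (eps * t) ^+ n * expR (s * (eps * t)) <= e * q (a * t).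
Proof.
have b1 : 0 < beta - 1 by rewrite subr_gt0.
(* The entry with [alpha + 3] yields the final exponent, [- a * kap / 4 + (beta - 1) / 4 <= - (alpha
   + 3)]; the last entry yields [eps <= a / 4]. *)
pose kap := Num.max 1 (Num.max ((4 * (alpha + 3) + (beta - 1)) / a) ((beta - 1) / a)).
have kap0 : 0 < kap by rewrite /kap lt_max ltr01.
have kap1 : (4 * (alpha + 3) + (beta - 1)) / a <= kap by rewrite !le_max lexx orbT.
have kap2 : (beta - 1) / a <= kap by rewrite !le_max lexx !orbT.
pose eps := (beta - 1) / 4 / kap.
have ke : kap * eps = (beta - 1) / 4 by rewrite /eps mulrC divfK// gt_eqF.
have eps0 : 0 < eps by rewrite !divr_gt0.
exists eps.
  rewrite eps0/= /eps ler_pdivrMr// mulrAC ler_pM2r ?invr_gt0//.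
  by rewrite mulrC -ler_pdivrMr.
move=> e e0.
pose s t := kap * ln t / t.
have a4 : 0 < a / 4 by rewrite divr_gt0.
have s_gt0 : \forall t \near +oo, 0 < s t.
  near=> t; have t1 : 1 < t by near: t; exact: near_pinfty_gt.
  by rewrite /s divr_gt0 ?mulr_gt0 ?ln_gt0// (lt_trans _ t1).
have s_le c : 0 < c -> \forall t \near +oo, s t <= c.
  move=> c0; have ck : 0 < c / kap by rewrite divr_gt0.
  near=> t; have t0 : 0 < t by near: t; exact: near_pinfty_gt.
  rewrite /s ler_pdivrMr// mulrC -ler_pdivlMr// mulrAC; near: t; exact: near_ln_le.
have s_cvg0 : s t @[t --> +oo] --> (0 : R).
  apply/cvgr0Pnorm_le => c c0; apply: filterS2 (s_le c c0) s_gt0 => t st st0.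
  by rewrite gtr0_norm.
have s_cvg : s t @[t --> +oo] --> (0 : R)^'+.
  move=> A HA; have h : \forall t \near +oo, (0 < s t -> A (s t)) := s_cvg0 _ HA.
  by apply: filterS2 h s_gt0 => t; apply.
have H1 : \forall t \near +oo, tmgf mu 1 (s t) (s t)^-1 <= 1 + (1 * - a + a / 4) * s t.
  exact: s_cvg _ (near_tmgf_le mu (- a) mu_int mu_mean 1 (a / 4) a4).
have [X [_ hX]] := F_up.
have H2 : \forall t \near +oo, F (s t)^-1 <= s t `^ beta.
  have X0 : 0 < (`|X| + 1)^-1 by rewrite invr_gt0 ltr_wpDl.
  near=> t; have st0 : 0 < s t by near: t.
  have st1 : s t <= (`|X| + 1)^-1 by near: t; exact: (s_le _ X0).
  rewrite (le_trans (hX _ _))//.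
    rewrite (@lt_le_trans _ _ (`|X| + 1))//; first by rewrite (le_lt_trans (ler_norm _))// ltrDl.
    by rewrite -[leLHS]invrK lef_pV2// posrE.
  by rewrite -powR_inv1 ?(ltW st0)// -powRrM mulrNN mul1r.
have H3 := near_ln_le_powR kap kap0.
have H4 := near_powR_le_locd_scale e (alpha + 3) e0 _.
have b4 : 0 < (beta - 1) / 4 by rewrite divr_gt0.
near=> t.
have t1 : 1 < t by near: t; exact: near_pinfty_gt.
have t0 : 0 < t by exact: lt_trans t1.
have l0 : 0 < ln t by rewrite ln_gt0.
have st0 : 0 < s t by near: t.
exists (s t).
  by rewrite (ltW st0)/=; near: t; exact: s_le.
move=> n tn.
have Eexp : expR (s t * (eps * t)) = t `^ ((beta - 1) / 4).
  rewrite /powR gt_eqF// -ke /s; congr expR; field; rewrite gt_eqF//.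
have h3 : s t <= t `^ (- 2^-1) by near: t; exact: H3.
have h4 : (a / 4)^-1 <= t `^ ((beta - 1) / 4) by near: t; exact: near_le_powR.
have h1 : tmgf mu 1 (s t) (s t)^-1 <= 1 + (1 * - a + a / 4) * s t by near: t; exact: H1.
have h2 : F (s t)^-1 <= s t `^ beta by near: t; exact: H2.
(* Jumps between [1 / s] and [eps * t]: since [s <= t ^ (- 1 / 2)], the product of
   [t ^ ((beta - 1) / 4)] and [s ^ beta] is at most [s * t ^ (- (beta - 1) / 4)], a small fraction
   of [s]. *)
have h5 : expR (s t * (eps * t)) * F (s t)^-1 <= a / 4 * s t.
  rewrite Eexp (@le_trans _ _ (t `^ ((beta - 1) / 4) * (s t * t `^ (- ((beta - 1) / 2)))))//.
    rewrite ler_wpM2l ?powR_ge0// (le_trans h2)// -mulr_powRB1 ?(ltW st0) ?(lt_trans _ beta_gt1)//.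
    rewrite ler_pM2l// (_ : - ((beta - 1) / 2) = - 2^-1 * (beta - 1)); last by field.
    by rewrite powRrM; apply: ge0_ler_powR => //; rewrite ?nnegrE ?powR_ge0// ltW.
  rewrite mulrCA mulrC ler_pM2r// -powRD ?(gt_eqF t0) ?implybT//.
  rewrite (_ : _ + _ = - ((beta - 1) / 4)); last by field.
  by rewrite powRN -[leRHS]invrK lef_pV2 ?posrE ?powR_gt0// invr_gt0.
(* Of the drift term [- a * s], the first-order expansion gives up a quarter and the larger jumps
   another quarter. *)
have M1 : tmgf mu 1 (s t) (eps * t) <= expR (- (a / 2 * s t)).
  rewrite (le_trans (tmgf_le_split _ _ st0))// (le_trans _ (expR_ge1Dx _))//.
  by move: h1 h5; rewrite mul1r mulrDl mulNr; lra.
have M2 : tmgf mu 1 (s t) (eps * t) ^+ n <= expR (- (a / 4 * kap * ln t)).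
  rewrite (@le_trans _ _ (expR (- (a / 2 * s t)) ^+ n))//.
    by rewrite lerXn2r// nnegrE ?expR_ge0 ?tmgf_ge0.
  rewrite -expRM_natl ler_expR mulrN lerN2.
  have -> : a / 4 * kap * ln t = (t / 2) * (a / 2 * s t).
    by rewrite /s; field; rewrite gt_eqF.
  by rewrite ler_wpM2r// mulr_ge0 ?(ltW st0)// divr_ge0// ltW.
rewrite (@le_trans _ _ (t `^ (- (alpha + 3))))//; last first.
  by near: t; apply: H4; lra.
rewrite (@le_trans _ _ (expR (- (a / 4 * kap * ln t)) * expR (s t * (eps * t))))//.
  by rewrite ler_wpM2r// expR_ge0.
rewrite Eexp /powR (gt_eqF t0) -expRD ler_expR -mulNr -mulrDl ler_pM2r//.
have := kap1; rewrite ler_pdivrMr// => kap1'; lra.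
Unshelve. all: by end_near. Qed.

End truncated_walk.

Section concentration.
Context {R : realType}.
Variables (nu : probability R R) (W : set R) (h : R -> \bar R) (c : R).
Hypotheses (mW : measurable W) (nh : nnm h) (nuW : (nu W <= c%:E)%E).

(** [W] is the exceptional set of the law of large numbers: the fine bound [S] holds off it, and the
    crude bound [C] only meets its small mass. *)
Lemma conv_le_off (S C : R) : 0 <= S -> 0 <= C ->
  (forall x, ~ W x -> (h x <= S%:E)%E) -> (forall x, (h x <= C%:E)%E) ->
  (conv nu setT h 0 <= (S + C * c)%:E)%E.
Proof.
move=> S0 C0 hS hC; rewrite (conv_setC nu W)// addeC EFinD leeD//.
  apply: le_trans (conv_cst_le nu (~` W) S 0 (measurableC mW) S0).
  apply: le_conv => //; first exact: measurableC.
  by move=> u /= Wu; rewrite add0r; exact: hS.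
apply: (@le_trans _ _ (C%:E * nu W)%E); last by rewrite EFinM lee_wpmul2l ?lee_fin.
rewrite -(conv_cst nu W C 0)//; exact: le_conv.
Qed.

Lemma conv_ge_off (S : R) : 0 <= S -> (forall x, ~ W x -> (S%:E <= h x)%E) ->
  ((S * (1 - c))%:E <= conv nu setT h 0)%E.
Proof.
move=> S0 hS; rewrite (conv_setC nu W)//.
apply: (@le_trans _ _ (conv nu (~` W) h 0)); last first.
  by rewrite leeDr// conv_ge0//; exact: nh.2.
apply: (@le_trans _ _ (S%:E * nu (~` W))%E).
  rewrite probability_setC// EFinM lee_wpmul2l ?lee_fin//.
  by rewrite EFinB leeB.
have mC : measurable (~` W) by exact: measurableC.
rewrite -(conv_cst nu (~` W) S 0)//; apply: le_conv => //.
by move=> u /= Wu; rewrite add0r; exact: hS.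
Qed.

End concentration.

(** * Upper and lower bounds by a single big jump *)

Section one_jump_bounds.
Context {d : measure_display} {T : measurableType d} {R : realType}.
Context {P : probability T R} {xi : R -> {RV P >-> R}}.
Hypothesis xi_levy : levy_process xi.
Variables (alpha lambda b : R).
Local Notation mu := (law xi 1).
Local Notation F := (tailF mu).
Local Notation q := (locd F alpha).
Hypothesis alpha_gt0 : 0 < alpha.
Hypothesis F_gt0 : forall x, 0 < F x.
Hypothesis F_loc : forall e, 0 < e -> (F y - F (y + e)) / q y @[y --> +oo] --> e.
Hypothesis lambda_gt0 : 0 < lambda.
Hypothesis bb : b * b = 1.

Definition gE (lambda b x : R) : \bar R := (gexp lambda b x)%:E.
Local Notation g := (gE lambda b).
Local Notation J z := (`]z, +oo[%classic : set R).

Lemma nnm_gE : nnm g.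
Proof.
split; first by apply/measurable_EFinP; exact: measurable_gexp.
by move=> x; rewrite lee_fin gexp_ge0.
Qed.

Let mJ (z : R) : measurable (J z). Proof. exact: measurable_itv. Qed.

Lemma conv_gE_gint (nu : probability R R) (D : set R) w : measurable D ->
  conv nu D g w = (gint lambda b nu D (- w))%:E.
Proof.
move=> mD; rewrite /gint /Rintegral fineK; last first.
  by apply: integrable_fin_num => //; exact: integrable_gexp.
by apply: eq_integral => u _; rewrite /gE opprK addrC.
Qed.

Lemma conv_mkcond0 (nu : probability R R) (D : set R) f x :
  conv nu D f x = conv nu setT (fun u => (f (x + u)%R * (\1_D u)%:E)%E) 0.
Proof. by rewrite conv_mkcond /conv; apply: eq_integral => u _; rewrite add0r. Qed.

Lemma nnm_mkcond (D : set R) f x : measurable D -> nnm f ->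
  nnm (fun u => (f (x + u)%R * (\1_D u)%:E)%E).
Proof.
move=> mD nf; split; last by move=> u; rewrite mule_ge0 ?lee_fin//; exact: nf.2.
apply: emeasurable_funM; first exact: nnm_shift.
by apply/measurable_EFinP; exact: measurable_indic.
Qed.

(* A jump of [xi r] forces, up to a bounded perturbation of fixed probability,
   a jump of [xi 1]. *)
Lemma frac_jump_le : exists C N z0, [/\ 0 < C, 0 < N, 1 + N < z0 &
  forall r z w, 0 <= r <= 1 -> z0 <= z -> (conv (law xi r) (J z) g w <= (C * q (z - N))%:E)%E].
Proof.
have [N [p [N0 p0 hp]]] := law_cball_ge xi_levy.
have [C [z0 [C0 z01 hC]]] := gint_tail_le mu alpha lambda b alpha_gt0 F_gt0 F_loc lambda_gt0 bb.
pose k := expR (2 * lambda * N).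
have k0 : 0 < k by exact: expR_gt0.
exists (k * C / p), (N + 1), (z0 + N + 1); split; [by rewrite divr_gt0// mulr_gt0|by lra|by lra|].
move=> r z w /andP[r0 r1] zz.
rewrite -(@lee_pmul2l _ p%:E)// -EFinM.
have -> : p * (k * C / p * q (z - (N + 1))) = k * (C * q (z - N - 1)).
  by rewrite (_ : z - (N + 1) = z - N - 1); [field; rewrite gt_eqF|ring].
have zz' : z0 <= z - N by lra.
have h := hC _ (- (w + b * N)) zz'.
(* [xi 1] adds to [xi r] an increment that stays within [N] with probability at least [p]: the sum
   still exceeds [z - N], and the start [w + b * N] keeps [g] comparable up to the factor [k]. *)
apply: (@le_trans _ _ (k%:E * conv mu (J (z - N)%R) g (w + b * N)%R)%E); last first.
  by rewrite conv_gE_gint// -EFinM lee_fin ler_pM2l.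
rewrite (conv_mkcond0 _ (J z)) (conv_mkcond0 _ (J (z - N))) -convZ ?(ltW k0)//; last by apply: nnm_mkcond => //; exact: nnm_gE.
have E1 : 1 = r + (1 - r) :> R by rewrite addrC subrK.
rewrite [in leRHS]E1.
apply: (conv_lawD_ge xi_levy _ _ _ (`[(- N)%R, N]%classic : set R)) => //.
- by rewrite subr_ge0.
- exact: ltW.
- by apply: nnm_mkcond => //; exact: nnm_gE.
- by apply: nnmZ; [exact: ltW|apply: nnm_mkcond => //; exact: nnm_gE].
- move=> y u /=; rewrite in_itv/= -ler_norml => uN.
  rewrite /gE -!EFinM lee_fin mulrA.
  have h1 : \1_(J z) y <= \1_(J (z - N)) (y + u) :> R.
    apply: le_indic; rewrite /= !in_itv/= !andbT => zy.
    by move: uN; rewrite ler_norml => /andP[u1 _]; lra.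
  apply: ler_pM => //; first exact: gexp_ge0.
  rewrite (_ : w + b * N + (y + u) = w + y + u + b * N); last by ring.
  exact: gexp_shift_le.
- by apply: hp; rewrite subr_ge0 r1 lerBlDr lerDl.
Qed.

Lemma iter_jump n (r : R) (J : set R) f x : 0 <= r -> measurable J -> nnm f ->
  iter n (conv mu setT) (conv mu J (conv (law xi r) setT f)) x =
  conv (law xi (n%:R + r)) setT (conv mu J f) x.
Proof.
move=> r0 mJ' nf; rewrite -(iter_conv_law xi_levy n r (conv mu J f))//; last exact: nnm_conv.
by congr (iter _ _ _ _); apply/funext => y; rewrite conv_comm.
Qed.

Let trunc_setC (z : R) : ~` [set u : R | 1 * u <= z] = J z.
Proof.
by apply/seteqP; split => u /=; rewrite mul1r in_itv/= andbT ltNge => /negP.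
Qed.

(** Some unit step exceeds [z], which gives the last term, or none does. In that case a fractional
    step up to [z] costs a factor [expR (s * z)] in Chernoff's bound, and a larger one is covered by
    [C1]. *)
Lemma one_jump_upper n (r s z C1 : R) : 0 <= r -> 0 <= s <= lambda -> 0 <= C1 ->
  (forall w, (conv (law xi r) (J z) g w <= C1%:E)%E) ->
  (conv (law xi (n.+2%:R + r)) setT g 0 <=
   (tmgf mu 1 s z ^+ n.+2 * expR (s * z) + C1)%:E +
   n.+2%:R%:E * conv (law xi (n.+1%:R + r)) setT (conv mu (J z) g) 0)%E.
Proof.
move=> r0 /andP[s0 sl] C10 hC1.
pose D := [set u : R | 1 * u <= z].
have mD : measurable D by exact: measurable_le_set.
have ng := nnm_gE; have nr : nnm (conv (law xi r) setT g) by exact: nnm_conv.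
rewrite -(iter_conv_law xi_levy)//.
apply: (le_trans (iter_conv_le mu D _ _ _ mD nr)).
rewrite /D trunc_setC iter_jump// leeD2r//.
pose e1 x : \bar R := ((expR (s * z))%:E * (expR (s * (1 * x)))%:E)%E.
have ne1 : nnm e1 by apply: nnmZ; [exact: expR_ge0|exact: nnm_expR].
have nc : nnm (cst C1%:E : R -> \bar R) by apply: nnm_cst; rewrite lee_fin.
apply: (@le_trans _ _ (iter n.+2 (conv mu D) (e1 \+ cst C1%:E) 0)).
  apply: le_iter_conv => //; first exact: nnmD.
  move=> y; rewrite (conv_setC _ D)// leeD//; last by rewrite /D trunc_setC.
  rewrite /e1 -EFinM -expRD.
  apply: le_trans (conv_cst_le (law xi r) D _ y mD (expR_ge0 _)).
  apply: le_conv => //; first by apply: nnm_cst; rewrite lee_fin expR_ge0.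
  move=> u; rewrite /D/= mul1r => uz; rewrite /gE lee_fin mul1r.
  have ss : 0 <= s <= lambda by rewrite s0.
  rewrite (le_trans (gexp_le_expR lambda b bb s _ ss))// ler_expR addrC mulrDr lerD2r.
  by rewrite ler_wpM2l.
rewrite iter_convD// /e1 iter_convZ ?expR_ge0//; last exact: nnm_expR.
rewrite iter_conv_expR// mulr0 mulr0 expR0 mulr1 -EFinM EFinD mulrC leeD//.
exact: iter_conv_cst.
Qed.

Lemma one_jump_lower n (r z C2 : R) : 0 <= r -> 0 <= C2 ->
  (forall w, (conv mu (J z) (conv mu (J z) g) w <= C2%:E)%E) ->
  (n.+2%:R%:E * conv (law xi (n.+1%:R + r)) setT (conv mu (J z) g) 0 <=
   conv (law xi (n.+2%:R + r)) setT g 0 + (n.+2%:R * n.+1%:R * C2)%:E)%E.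
Proof.
move=> r0 C20 hC2.
pose D := [set u : R | 1 * u <= z].
have mD : measurable D by exact: measurable_le_set.
have ng := nnm_gE; have nr : nnm (conv (law xi r) setT g) by exact: nnm_conv.
have nJ f : nnm f -> nnm (conv mu (J z) f) by exact: nnm_conv.
have comm f : nnm f -> conv mu (J z) (conv (law xi r) setT f) =
    conv (law xi r) setT (conv mu (J z) f).
  by move=> nf; apply/funext => y; rewrite conv_comm.
rewrite -iter_jump// -(iter_conv_law xi_levy)//.
have := iter_conv_bonferroni mu D (conv (law xi r) setT g) n 0 mD nr.
rewrite /D trunc_setC => /le_trans; apply; rewrite leeD2l//.
rewrite [in leRHS]EFinM lee_wpmul2l ?lee_fin ?mulr_ge0//.
rewrite (comm _ ng) (comm _ (nJ _ ng)).
have nBB : nnm (conv mu (J z) (conv mu (J z) g)) by apply: nnm_conv => //; exact: nnm_conv.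
apply: le_trans (iter_conv_cst mu setT C2 n 0 measurableT C20).
apply: le_iter_conv => //; first exact: nnm_conv.
move=> y; apply: le_trans (conv_cst_le (law xi r) setT C2 y measurableT C20).
exact: le_conv.
Qed.

End one_jump_bounds.

(** Both expressions are continuous in [kap] with value [c] at 0. Their factors in [1 - kap] and
    [1 + kap] are the limits of [q (k * y) / q y] for these two values of [k]. *)
Lemma powR_perturb {R : realType} (alpha c e : R) : 0 < c -> 0 < e ->
  exists kap : R, [/\ 0 < kap, kap <= 2^-1, kap <= c,
    (c + kap) * ((1 - kap)^-1 * (1 - kap) `^ (- alpha)) < c + e &
    c - e < (c - kap) * ((1 + kap)^-1 * (1 + kap) `^ (- alpha))].
Proof.
move=> c0 e0.
have lnc : {for (1 : R), continuous (@ln R)} by exact: continuous_ln.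
have id0 : (x : R) @[x --> (0 : R)^'+] --> (0 : R).
  by apply: cvg_within_filter; exact: cvg_id.
have powc (f : R -> R) : f x @[x --> (0 : R)^'+] --> (1 : R) ->
    expR (- alpha * ln (f x)) @[x --> (0 : R)^'+] --> (1 : R).
  move=> f1; rewrite [X in _ --> X](_ : _ = expR (- alpha * ln 1)); last first.
    by rewrite ln1 mulr0 expR0.
  apply: continuous_cvg; first exact: continuous_expR.
  by apply: cvgMl_tmp; apply: (continuous_cvg _ lnc).
have L1 : (c + x) * ((1 - x)^-1 * expR (- alpha * ln (1 - x))) @[x --> (0 : R)^'+] --> (c + 0) * (1^-1 * 1).
  have h : 1 - x @[x --> (0 : R)^'+] --> (1 : R).
    by rewrite -[X in _ --> X]subr0; apply: cvgB => //; exact: cvg_cst.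
  apply: cvgM; first by apply: cvgD => //; exact: cvg_cst.
  apply: cvgM; last exact: (powc (fun x => 1 - x)).
  by apply: cvgV => //; exact: oner_neq0.
have L2 : (c - x) * ((1 + x)^-1 * expR (- alpha * ln (1 + x))) @[x --> (0 : R)^'+] --> (c - 0) * (1^-1 * 1).
  have h : 1 + x @[x --> (0 : R)^'+] --> (1 : R).
    by rewrite -[X in _ --> X]addr0; apply: cvgD => //; exact: cvg_cst.
  apply: cvgM; first by apply: cvgB => //; exact: cvg_cst.
  apply: cvgM; last exact: (powc (fun x => 1 + x)).
  by apply: cvgV => //; exact: oner_neq0.
rewrite addr0 invr1 !mulr1 in L1; rewrite subr0 invr1 !mulr1 in L2.
have H1 := cvgr_lt _ L1 (c + e); have H2 := cvgr_gt _ L2 (c - e).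
have [k] : exists k : R, [/\ 0 < k, k <= 2^-1, k <= c,
    (c + k) * ((1 - k)^-1 * expR (- alpha * ln (1 - k))) < c + e &
    c - e < (c - k) * ((1 + k)^-1 * expR (- alpha * ln (1 + k)))].
  near ((0 : R)^'+) => k; exists k; split.
  - by near: k; exact: nbhs_right_gt.
  - by near: k; apply: nbhs_right_le; rewrite invr_gt0.
  - by near: k; exact: nbhs_right_le.
  - by near: k; apply: H1; rewrite ltrDl.
  - by near: k; apply: H2; rewrite gtrBl.
move=> [k0 k2 kc h1 h2]; exists k; split => //.
  by rewrite /powR gt_eqF//; lra.
by rewrite /powR gt_eqF//; lra.
Unshelve. all: by end_near. Qed.

Section final_bookkeeping.
Context {R : realType}.
Variables (t Q V m c e li : R).
Hypotheses (t1 : 1 <= t) (Q0 : 0 < Q) (c0 : 0 <= c) (e0 : 0 < e) (li0 : 0 < li).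

Let t0 : 0 <= t. Proof. exact: le_trans ler01 t1. Qed.

(** [A] stands for small steps throughout, [B] for a big fractional step, [S] and [D] for a big unit
    step from a typical and from an exceptional position. Each accounts for one of the four [e]. *)
Lemma upper_budget (A B S D : R) : 0 <= m <= t ->
  A <= e * Q -> B <= e * t * Q -> S <= (li + e) * Q -> D <= e * Q ->
  V <= A + B + m * (S + D) -> V <= (li + 4 * e) * (t * Q).
Proof.
move=> /andP[m0 mt] hA hB hS hD hV.
have hA' : A <= e * t * Q.
  by rewrite (le_trans hA)// ler_pM2r// ler_peMr// ltW.
have hm : m * (S + D) <= t * ((li + 2 * e) * Q).
  rewrite (@le_trans _ _ (m * ((li + 2 * e) * Q)))//.
    by rewrite ler_wpM2l//; lra.
  by apply: ler_wpM2r => //; apply: mulr_ge0; [rewrite addr_ge0 ?mulr_ge0 ?ltW|exact: ltW].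
rewrite (le_trans hV)//.
have -> : (li + 4 * e) * (t * Q) = e * t * Q + e * t * Q + t * ((li + 2 * e) * Q) by ring.
by rewrite !lerD.
Qed.

(** Four losses of at most [e] each: [t - 1] in place of [t], the exceptional mass [c], the error in
    [S], and the correction [B] for two big jumps. *)
Lemma lower_budget (S B : R) : t - 1 <= m -> c <= 1 -> e < li -> li * c <= e -> li <= e * t ->
  (li - e) * Q <= S -> B <= e * t * Q -> m * (S * (1 - c)) <= V + B ->
  (li - 4 * e) * (t * Q) <= V.
Proof.
move=> tm c1 eli lc lt hS hB hV.
have c1' : 0 <= 1 - c by rewrite subr_ge0.
have le0 : 0 <= li - e by rewrite subr_ge0 ltW.
have h : (t - 1) * ((li - e) * Q * (1 - c)) <= m * (S * (1 - c)).
  apply: ler_pM => //; first by rewrite subr_ge0.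
    by rewrite !mulr_ge0// ltW.
  exact: ler_wpM2r.
suff : (li - 3 * e) * (t * Q) <= (t - 1) * ((li - e) * Q * (1 - c)).
  have : (li - 3 * e) * (t * Q) = (li - 4 * e) * (t * Q) + e * t * Q by ring.
  by lra.
rewrite [leLHS]mulrA (_ : _ * (_ * _ * _) = (t - 1) * (li - e) * (1 - c) * Q); last by ring.
rewrite ler_pM2r//.
have -> : (t - 1) * (li - e) * (1 - c) =
    li * t - e * t - li * c * t + e * c * t - (li - e) * (1 - c) by ring.
have h1 : li * c * t <= e * t by exact: ler_wpM2r.
have h2 : 0 <= e * c * t by rewrite !mulr_ge0// ltW.
have h3 : (li - e) * (1 - c) <= e * t.
  rewrite (le_trans _ lt)// (@le_trans _ _ (li - e))//.
    by rewrite ler_piMr// gerBl.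
  by rewrite gerBl ltW.
by rewrite mulrBl; lra.
Qed.

End final_bookkeeping.

Lemma measurable_dist_set {R : realType} (c e : R) : measurable [set x : R | e < `|x + c|].
Proof.
rewrite (_ : [set _ | _] = (fun x : R => `|x + c|) @^-1` `]e, +oo[%classic); last first.
  by apply/seteqP; split => u /=; rewrite in_itv/= andbT.
rewrite -[X in measurable X]setTI.
have mf : measurable_fun setT (fun x : R => `|x + c|).
  by apply: measurableT_comp => //; exact: measurable_funD.
by apply: mf => //; exact: measurable_itv.
Qed.

Lemma half_leB {R : realFieldType} (z x : R) : x <= z / 2 -> z / 2 <= z - x.
Proof. by move=> ?; lra. Qed.

Lemma gap_le {R : realFieldType} (a eps kap t x : R) : eps <= a / 4 -> kap <= 2^-1 -> 0 < t -> 0 < a ->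
  (1 - kap) * (a * t) <= x -> a / 4 * t <= x - eps * t.
Proof.
move=> ea k2 t0 a0 hx.
have h1 : eps * t <= a / 4 * t by rewrite ler_pM2r.
have h2 : 2^-1 * (a * t) <= (1 - kap) * (a * t) by rewrite ler_pM2r ?mulr_gt0//; lra.
lra.
Qed.

Lemma off_bounds {R : realFieldType} (k u x : R) :
  `|x + u| <= k * u -> (1 - k) * u <= - x <= (1 + k) * u.
Proof. by rewrite ler_norml => /andP[? ?]; apply/andP; split; lra. Qed.

Lemma halves_le {R : realFieldType} (li e Q G G' x : R) :
  G <= G' + x -> x <= e / 2 * Q -> (li - e / 2) * Q <= G -> (li - e) * Q <= G'.
Proof. by move=> ? ? ?; lra. Qed.

Lemma truncn_decomp {R : realType} (t : R) : 3 <= t -> exists n (r : R), [/\ 0 <= r <= 1,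
  t = n.+2%:R + r, t - 1 = n.+1%:R + r, n.+2%:R <= t & t - 1 <= n.+2%:R /\ t / 2 <= n.+2%:R].
Proof.
move=> t3; have t0 : 0 <= t by lra.
have [n nE] : exists n, Num.truncn t = n.+2.
  case E : (Num.truncn t) => [|[|n]]; last by exists n.
    by have := truncnS_gt t; rewrite E; lra.
  by have := truncnS_gt t; rewrite E; lra.
have /andP[] := truncn_itv t0; rewrite nE -(natr1 n.+2) => h1 h2.
have e2 : n.+2%:R = n.+1%:R + 1 :> R by rewrite natr1.
exists n, (t - n.+2%:R); split.
- by apply/andP; split; lra.
- by lra.
- by lra.
- exact: h1.
- by split; lra.
Qed.

(** * Asymptotics of [E g(xi_t)] *)

Section big_jump.
Context {d : measure_display} {T : measurableType d} {R : realType}.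
Context {P : probability T R} {xi : R -> {RV P >-> R}}.
Hypothesis xi_levy : levy_process xi.
Variables (a alpha beta lambda b : R).
Local Notation mu := (law xi 1).
Local Notation F := (tailF mu).
Local Notation q := (locd F alpha).
Hypothesis xi_int : mu.-integrable setT (EFin : R -> \bar R).
Hypothesis xi_mean : (\int[mu]_u u%:E = (- a)%:E)%E.
Hypothesis a_gt0 : 0 < a.
Hypothesis alpha_gt1 : 1 < alpha.
Hypothesis beta_gt1 : 1 < beta.
Hypothesis F_gt0 : forall x, 0 < F x.
Hypothesis F_scale : forall k, 0 < k -> F (k * x) / F x @[x --> +oo] --> k `^ (- alpha).
Hypothesis F_loc : forall e, 0 < e -> (F y - F (y + e)) / q y @[y --> +oo] --> e.
Hypothesis F_up : \forall x \near +oo, F x <= x `^ (- beta).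
Hypothesis F_low : \forall x \near +oo, x `^ (- (alpha + 1)) <= F x.
Hypothesis lambda_gt0 : 0 < lambda.
Hypothesis bb : b * b = 1.
Local Notation g := (gE lambda b).
Local Notation J z := (`]z, +oo[%classic : set R).
Local Notation G := (gint lambda b mu setT).

Let alpha_gt0 : 0 < alpha. Proof. exact: lt_trans alpha_gt1. Qed.
Let mJ (z : R) : measurable (J z). Proof. exact: measurable_itv. Qed.
Let ng : nnm g. Proof. exact: nnm_gE. Qed.
Let F_ni : forall x y, x <= y -> F y <= F x. Proof. exact: tailF_ni. Qed.
Let li : R := lambda^-1.
Let li_gt0 : 0 < li. Proof. by rewrite invr_gt0. Qed.

Lemma gint_subset (nu : probability R R) D y : measurable D ->
  gint lambda b nu D y <= gint lambda b nu setT y.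
Proof.
move=> mD; rewrite -lee_fin -[y]opprK -!conv_gE_gint// (conv_setC nu D)//.
by rewrite leeDl// conv_ge0//; exact: ng.2.
Qed.

Lemma near_locd_scale_le k c : 0 < k -> k^-1 * k `^ (- alpha) < c ->
  \forall t \near +oo, q (k * (a * t)) <= c * q (a * t).
Proof.
move=> k0 kc.
have H := cvgr_le _ (cvg_scale _ _ a a_gt0 (locd_scale F alpha alpha_gt0 F_gt0 F_scale _ k0)) _ kc.
near=> t; have t0 : 0 < t by near: t; exact: near_pinfty_gt.
by rewrite -ler_pdivrMr ?locd_gt0 ?mulr_gt0//; near: t; exact: H.
Unshelve. all: by end_near. Qed.

Lemma near_locd_scale_ge k c : 0 < k -> c < k^-1 * k `^ (- alpha) ->
  \forall t \near +oo, c * q (a * t) <= q (k * (a * t)).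
Proof.
move=> k0 kc.
have H := cvgr_ge _ (cvg_scale _ _ a a_gt0 (locd_scale F alpha alpha_gt0 F_gt0 F_scale _ k0)) _ kc.
near=> t; have t0 : 0 < t by near: t; exact: near_pinfty_gt.
by rewrite -ler_pdivlMr ?locd_gt0 ?mulr_gt0//; near: t; exact: H.
Unshelve. all: by end_near. Qed.

Lemma near_mul_tailF_le (k e : R) : 0 < k -> 0 < e -> \forall t \near +oo, t * F (k * t) <= e.
Proof.
move=> k0 e0; have H := near_affine _ _ 0 k0 F_up.
have b1 : 0 < beta - 1 by rewrite subr_gt0.
have kb := powR_gt0 (- beta) k0.
near=> t; have t0 : 0 < t by near: t; exact: near_pinfty_gt.
have h1 : F (k * t) <= (k * t) `^ (- beta) by rewrite -[k * t]addr0; near: t; exact: H.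
have h2 : k `^ (- beta) / e <= t `^ (beta - 1) by near: t; exact: near_le_powR.
rewrite powRM ?(ltW k0) ?(ltW t0)// in h1.
rewrite (@le_trans _ _ (t * (k `^ (- beta) * t `^ (- beta))))//; first by rewrite ler_pM2l.
have -> : t * (k `^ (- beta) * t `^ (- beta)) = k `^ (- beta) / t `^ (beta - 1).
  rewrite powRB ?(gt_eqF t0) ?implybT// powRr1 ?(ltW t0)// [t `^ (- beta)]powRN.
  by field; rewrite !gt_eqF// powR_gt0.
by rewrite ler_pdivrMr ?powR_gt0// (mulrC e) -ler_pdivrMr.
Unshelve. all: by end_near. Qed.

(** The time is [t - 1] because the big unit step has been removed; passing from [k] to [k / 2]
    leaves room for recentring at [- a * t]. *)
Lemma near_law_off (k c : R) : 0 < k -> 0 < c ->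
  \forall t \near +oo, (law xi (t - 1)%R [set x : R | (k * t < `|x + a * t|)%R] <= c%:E)%E.
Proof.
move=> k0 c0; have k2 : 0 < k / 2 by rewrite divr_gt0.
have H := near_affine _ 1 (-1) ltr01 (law_weak_lln xi_levy (- a) xi_int xi_mean _ _ k2 c0).
near=> t.
have h : (law xi (t - 1)%R [set x : R | (k / 2 * (t - 1) < `|x - - a * (t - 1)|)%R] <= c%:E)%E.
  by near: t; apply: filterS H => t; rewrite mul1r.
have tbig : 2 * a / k <= t by near: t; exact: near_pinfty_ge.
apply: le_trans h; apply: le_measure; rewrite ?inE.
- exact: measurable_dist_set.
- exact: measurable_dist_set.
move=> x /= xt; rewrite mulNr opprK.
have h1 : `|x + a * t| <= `|x + a * (t - 1)| + a.
  rewrite (_ : x + a * t = x + a * (t - 1) + a); last by ring.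
  by rewrite (le_trans (ler_normD _ _))// (gtr0_norm a_gt0).
have h2 : 2 * a <= t * k by rewrite -ler_pdivrMr.
by rewrite mulrBr mulr1; lra.
Unshelve. all: by end_near. Qed.

Lemma big_jump_cvg : gint lambda b (law xi t) setT 0 / (t * q (a * t)) @[t --> +oo] --> li.
Proof.
have [C [z0 [C0 z01 hC]]] := gint_tail_le mu alpha lambda b alpha_gt0 F_gt0 F_loc lambda_gt0 bb.
have [Cf [Nf [zf [Cf0 Nf0 zf1 hCf]]]] :=
  frac_jump_le xi_levy alpha lambda b alpha_gt0 F_gt0 F_loc lambda_gt0 bb.
have [eps /andP[eps0 epsa] hchern] := near_truncated_chernoff mu a alpha beta lambda
  xi_int xi_mean a_gt0 alpha_gt1 beta_gt1 lambda_gt0 F_up F_low.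
have Gcvg := gint_cvg mu alpha lambda b alpha_gt0 F_gt0 F_scale F_loc lambda_gt0 bb F_low.
apply/cvgrPdist_le => e e_gt0.
(* The budgets lose [4 * e1]; keeping [e1] below [li] makes [li - e1] positive. *)
pose e1 := Num.min (e / 4) (li / 2).
have e1_gt0 : 0 < e1 by rewrite lt_min !divr_gt0.
have e1e : 4 * e1 <= e by rewrite mulrC -ler_pdivlMr// ge_min lexx.
have e1l : e1 < li.
  have h : e1 <= li / 2 by rewrite ge_min lexx orbT.
  by rewrite (le_lt_trans h)// ltr_pdivrMr// ltr_pMr// ltr1n.
have e2_gt0 : 0 < e1 / 2 by rewrite divr_gt0.
have [kap [kap0 kap2 kapl Hk1 Hk2]] := powR_perturb alpha li (e1 / 2) li_gt0 e2_gt0.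
have k1 : 0 < 1 - kap by lra.
have k1' : 0 < 1 + kap by lra.
(* [K0] bounds [q (eps / 2 * t) / q (a * t)] *)
pose kk := eps / 2 / a.
have kk0 : 0 < kk by rewrite !divr_gt0.
pose K0 := kk^-1 * kk `^ (- alpha) + 1.
have K00 : 0 < K0 by rewrite ltr_wpDl// mulr_ge0 ?powR_ge0// invr_ge0 ltW.
(* One entry for each use of the exceptional mass: with the crude bound [C * K0 * Q] from above,
   with [li] from below, and in [1 - c >= 0]. *)
pose c := Num.min (e1 / (C * K0)) (Num.min (e1 / li) 1).
have c0 : 0 < c by rewrite !lt_min !divr_gt0 ?ltr01// mulr_gt0.
have cC : c <= e1 / (C * K0) by rewrite ge_min lexx.
have cl : c <= e1 / li by rewrite !ge_min lexx orbT.
have c1 : c <= 1 by rewrite !ge_min lexx !orbT.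
have ka0 : 0 < kap * a by rewrite mulr_gt0.
have HW := near_law_off _ _ ka0 c0.
have HK0 : \forall t \near +oo, q (kk * (a * t)) <= K0 * q (a * t).
  by apply: near_locd_scale_le => //; rewrite /K0 ltrDl.
have Hk1' : \forall t \near +oo, q ((1 - kap) * (a * t)) <= (li + e1) / (li + kap) * q (a * t).
  apply: near_locd_scale_le => //; rewrite ltr_pdivlMr ?addr_gt0// mulrC (lt_le_trans Hk1)//.
  by rewrite lerD2l ler_pdivrMr// ler_peMr ?ler1n// ltW.
have Hch := hchern e1 e1_gt0.
have lkap : 0 < li - kap.
  have p0 : 0 < (1 + kap)^-1 * (1 + kap) `^ (- alpha) by rewrite mulr_gt0 ?invr_gt0 ?powR_gt0.
  have h : 0 < li - e1 / 2.
    by rewrite subr_gt0 (lt_trans _ e1l)// ltr_pdivrMr// ltr_pMr// ltr1n.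
  by rewrite -(pmulr_lgt0 _ p0) (lt_trans h).
have Hk2' : \forall t \near +oo, (li - e1 / 2) / (li - kap) * q (a * t) <= q ((1 + kap) * (a * t)).
  by apply: near_locd_scale_ge => //; rewrite ltr_pdivrMr// [ltRHS]mulrC.
have [M [_ hM]] : \forall y \near +oo, `|li - G y / q y| <= kap.
  by move/cvgrPdist_le : Gcvg; apply.
have la4 : 0 < lambda * (a / 4) by rewrite mulr_gt0// divr_gt0.
have Hexp := near_expR_le_locd_scale mu a alpha a_gt0 alpha_gt1 F_low _ _ la4 e2_gt0.
have HF : \forall t \near +oo, t * F (eps * t) <= e1 / (C * K0).
  by apply: near_mul_tailF_le => //; rewrite divr_gt0// mulr_gt0.
near=> t.
have t3 : 3 <= t by near: t; exact: near_pinfty_ge.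
have t0 : 0 < t by exact: lt_le_trans t3.
have at0 : 0 < a * t by rewrite mulr_gt0.
have tM : M / ((1 - kap) * a) < t by near: t; exact: near_pinfty_gt.
have tz0 : z0 / eps <= t by near: t; exact: near_pinfty_ge.
have tzf : zf / eps <= t by near: t; exact: near_pinfty_ge.
have tN : 2 * (Nf + 1) / eps <= t by near: t; exact: near_pinfty_ge.
have tC : Cf * K0 / e1 <= t by near: t; exact: near_pinfty_ge.
have tl : li / e1 <= t by near: t; exact: near_pinfty_ge.
have tW : (law xi (t - 1)%R [set x : R | (kap * a * t < `|x + a * t|)%R] <= c%:E)%E by near: t.
have tK0 : q (kk * (a * t)) <= K0 * q (a * t) by near: t.
have tk1 : q ((1 - kap) * (a * t)) <= (li + e1) / (li + kap) * q (a * t) by near: t.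
have tk2 : (li - e1 / 2) / (li - kap) * q (a * t) <= q ((1 + kap) * (a * t)) by near: t.
have texp : expR (- (lambda * (a / 4) * t)) <= e1 / 2 * q (a * t) by near: t; exact: Hexp.
have tF : t * F (eps * t) <= e1 / (C * K0) by near: t.
have [s sl tch] : exists2 s : R, 0 <= s <= lambda & forall n : nat, t / 2 <= n%:R ->
    tmgf mu 1 s (eps * t) ^+ n * expR (s * (eps * t)) <= e1 * q (a * t) by near: t.
have {}tM : M < (1 - kap) * (a * t).
  by rewrite mulrA mulrC -ltr_pdivrMr// mulr_gt0.
rewrite ler_pdivrMr// in tz0; rewrite ler_pdivrMr// in tzf; rewrite ler_pdivrMr// in tN.
rewrite ler_pdivrMr// in tC; rewrite ler_pdivrMr// in tl.
pose z := eps * t; pose Q := q (a * t).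
have Q0 : 0 < Q by exact: locd_gt0.
have kkE : kk * (a * t) = z / 2 by rewrite /kk /z; field; rewrite gt_eqF.
have t1 : 1 <= t by rewrite (le_trans _ t3)// ler1n.
have [n [r [/andP[r0 r1] tE tE1 nt [tn t2n]]]] := truncn_decomp _ t3.
have zN : Nf + 1 <= z / 2 by rewrite ler_pdivlMr// mulrC /z (mulrC eps).
have z2 : 1 < z / 2 by rewrite (lt_le_trans _ zN)// ltrDr.
have zN1 : z / 2 <= z - 1 by exact/half_leB/ltW.
have zN2 : z / 2 <= z - Nf by apply: half_leB; rewrite (le_trans _ zN)// lerDl.
(* Used at [z - 1] and [z - Nf], to make the crude bounds on big jumps of order [Q]. *)
have zQ x : z / 2 <= x -> q x <= K0 * Q.
  move=> zx; apply: le_trans tK0; rewrite kkE; apply: locd_ni => //.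
  by rewrite divr_gt0// mulr_gt0.
have qz1 : q (z - 1) <= K0 * Q by apply: zQ.
have qzN : q (z - Nf) <= K0 * Q by apply: zQ.
have qz0 : 0 <= q (z - 1) by apply/ltW/locd_gt0 => //; rewrite (lt_le_trans _ zN1)// (lt_trans _ z2).
have qzN0 : 0 <= q (z - Nf) by apply/ltW/locd_gt0 => //; rewrite (lt_le_trans _ zN2)// (lt_trans _ z2).
have jump w : (conv mu (J z) g w <= (C * q (z - 1))%:E)%E.
  by rewrite conv_gE_gint// lee_fin; apply: hC; rewrite /z mulrC.
have Cq0 : 0 <= C * q (z - 1) by rewrite mulr_ge0// ltW.
pose V := gint lambda b (law xi t) setT 0.
have VE : conv (law xi t) setT g 0 = V%:E by rewrite conv_gE_gint// oppr0.
pose W := [set x : R | kap * a * t < `|x + a * t|].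
have mW : measurable W by exact: measurable_dist_set.
have nJ : nnm (conv mu (J z) g) by exact: nnm_conv.
have offW x : ~ W x -> (1 - kap) * (a * t) <= - x <= (1 + kap) * (a * t).
  by move=> /negP; rewrite -leNgt -mulrA; exact: off_bounds.
have Gq x : ~ W x -> (li - kap) * q (- x) <= G (- x) <= (li + kap) * q (- x).
  move=> /offW /andP[x1 x2].
  have : `|li - G (- x) / q (- x)| <= kap by apply: hM; exact: lt_le_trans x1.
  have qx : 0 < q (- x) by apply: locd_gt0 => //; rewrite (lt_le_trans _ x1)// mulr_gt0.
  by rewrite distrC ler_distl ler_pdivlMr// ler_pdivrMr.
have K0Q : C * K0 * (e1 / (C * K0)) = e1 by rewrite mulrC divfK// gt_eqF// mulr_gt0.
have CqK : C * q (z - 1) <= C * K0 * Q by rewrite -mulrA ler_pM2l.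
have up : V <= (li + 4 * e1) * (t * Q).
  have S0 : 0 <= (li + kap) * q ((1 - kap) * (a * t)).
    by rewrite mulr_ge0 ?addr_ge0 ?(ltW li_gt0) ?(ltW kap0)// ltW// locd_gt0// mulr_gt0.
  have hS x : ~ W x -> (conv mu (J z) g x <= ((li + kap) * q ((1 - kap) * (a * t)))%:E)%E.
    move=> Wx; have /andP[x1 _] := offW x Wx; have /andP[_ g2] := Gq x Wx.
    rewrite conv_gE_gint// lee_fin (le_trans (gint_subset _ _ _ (mJ z)))// (le_trans g2)//.
    by rewrite ler_pM2l ?addr_gt0// locd_ni// mulr_gt0.
  have := conv_le_off _ W _ _ mW nJ tW _ _ S0 Cq0 hS jump.
  rewrite tE1 => hconv.
  have C10 : 0 <= Cf * q (z - Nf) by rewrite mulr_ge0// ltW.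
  have hr w : (conv (law xi r) (J z) g w <= (Cf * q (z - Nf))%:E)%E.
    by apply: hCf; [rewrite r0|rewrite /z mulrC].
  have := one_jump_upper xi_levy lambda b bb n r s z _ r0 sl C10 hr.
  rewrite -tE VE => H.
  have {}H : (V%:E <= (tmgf mu 1 s z ^+ n.+2 * expR (s * z) + Cf * q (z - Nf) +
      n.+2%:R * ((li + kap) * q ((1 - kap) * (a * t)) + C * q (z - 1) * c))%:E)%E.
    by apply: (le_trans H); rewrite [in leRHS]EFinD leeD2l// [in leRHS]EFinM lee_wpmul2l ?lee_fin.
  rewrite lee_fin in H.
  apply: (upper_budget t Q V n.+2%:R e1 li t1 Q0 e1_gt0 li_gt0 _ (Cf * q (z - Nf))
    ((li + kap) * q ((1 - kap) * (a * t))) (C * q (z - 1) * c) _ (tch n.+2 t2n)).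
  - by rewrite ler0n.
  - by rewrite (le_trans (ler_wpM2l (ltW Cf0) qzN))// mulrA ler_pM2r// (mulrC e1).
  - have lk0 : 0 < li + kap by rewrite addr_gt0.
    rewrite (_ : (li + e1) * Q = (li + kap) * ((li + e1) / (li + kap) * Q)) ?ler_pM2l//.
    by rewrite [RHS]mulrA (mulrC (li + kap)) divfK// gt_eqF.
  - rewrite (le_trans (ler_wpM2r (ltW c0) CqK))// mulrAC ler_pM2r//.
    by rewrite -[leRHS]K0Q ler_pM2l// mulr_gt0.
  - exact: H.
have low : (li - 4 * e1) * (t * Q) <= V.
  have S0 : 0 <= (li - e1) * Q by rewrite mulr_ge0 ?(ltW Q0)// subr_ge0 ltW.
  have hS x : ~ W x -> (((li - e1) * Q)%:E <= conv mu (J z) g x)%E.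
    move=> Wx; have /andP[x1 x2] := offW x Wx; have /andP[g1 _] := Gq x Wx.
    rewrite conv_gE_gint// lee_fin.
    have qx0 : 0 < - x by rewrite (lt_le_trans _ x1)// mulr_gt0.
    (* Dropping the jumps up to [z] costs [expR (- (lambda * (- x - z)))]. It is negligible against
       [Q], because [- x] is at least [a * t / 2] and [z] at most [a * t / 4]. *)
    have zx : lambda * (a / 4) * t <= lambda * (- x - z).
      rewrite -mulrA ler_pM2l//; apply: gap_le epsa kap2 t0 a_gt0 x1.
    have zx0 : z <= - x.
      by rewrite -subr_ge0 -(pmulr_rge0 _ lambda_gt0) (le_trans _ zx)// !mulr_ge0// ltW// divr_gt0.
    have h1 := gint_le_tail mu lambda b lambda_gt0 bb _ _ zx0.
    have h2 : expR (- (lambda * (- x - z))) <= e1 / 2 * Q.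
      by rewrite (le_trans _ texp)// ler_expR lerN2.
    have h3 : (li - e1 / 2) * Q <= G (- x).
      rewrite (le_trans _ g1)// (@le_trans _ _ ((li - kap) * q ((1 + kap) * (a * t))))//.
        rewrite (_ : (li - e1 / 2) * Q = (li - kap) * ((li - e1 / 2) / (li - kap) * Q)) ?ler_pM2l//.
        by rewrite [RHS]mulrA (mulrC (li - kap)) divfK// gt_eqF.
      by rewrite ler_pM2l// locd_ni.
    exact: halves_le h1 h2 h3.
  have := conv_ge_off _ W _ _ mW nJ tW _ S0 hS; rewrite tE1 => hconv.
  (* For two big jumps, one is bounded by [C * q (z - 1)] uniformly in the starting point and the
     other has mass [F z]. Of the two factors [t], one is paid for by [t * F z]. *)
  pose C3 := C * q (z - 1) * F z.
  have C30 : 0 <= C3 by rewrite mulr_ge0// ltW.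
  have hC3 w : (conv mu (J z) (conv mu (J z) g) w <= C3%:E)%E.
    rewrite EFinM /tailF fineK ?fin_num_measure// -(conv_cst mu (J z) _ w)//.
    exact: le_conv.
  have := one_jump_lower xi_levy lambda b n r z C3 r0 C30 hC3.
  rewrite -tE VE => H.
  have {}H : ((n.+2%:R * ((li - e1) * Q * (1 - c)))%:E <= (V + n.+2%:R * n.+1%:R * C3)%:E)%E.
    by rewrite [in leRHS]EFinD; apply: le_trans H; rewrite EFinM lee_wpmul2l ?lee_fin.
  rewrite lee_fin in H.
  apply: (lower_budget t Q V n.+2%:R c e1 li t1 Q0 (ltW c0) e1_gt0 _ (n.+2%:R * n.+1%:R * C3)
    tn c1 e1l _ _ (lexx _) _ H).
  - by rewrite mulrC -ler_pdivlMr.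
  - by rewrite mulrC.
  - rewrite (@le_trans _ _ (t * t * C3))//.
      rewrite ler_wpM2r// ler_pM// (le_trans _ nt)// ler_nat//.
    rewrite /C3 (@le_trans _ _ (t * t * (C * K0 * Q * F z)))//.
      by rewrite ler_pM2l ?mulr_gt0// ler_pM2r.
    have -> : t * t * (C * K0 * Q * F z) = C * K0 * (t * F z) * t * Q by ring.
    rewrite ler_pM2r// ler_pM2r// -[leRHS]K0Q ler_pM2l// mulr_gt0//.
have tQ : 0 < t * Q by rewrite mulr_gt0.
rewrite -/V -/Q distrC ler_distl ler_pdivlMr// ler_pdivrMr//.
rewrite (le_trans _ low) ?(le_trans up)// ler_pM2r//.
  by rewrite lerD2l.
by rewrite lerD2l lerN2.
Unshelve. all: by end_near. Qed.

End big_jump.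

(** * From the random variables to their laws *)

(** By convention [+oo - +oo] is infinite, so a finite value of the integral forces both the
    positive and the negative part to have a finite integral. *)
Lemma fin_integral_integrable {d : measure_display} {T : measurableType d} {R : realType}
    (mu : {measure set T -> \bar R}) (f : T -> \bar R) :
  measurable_fun setT f -> (\int[mu]_x f x \is a fin_num)%E -> mu.-integrable setT f.
Proof.
move=> mf; rewrite integralE => fin; apply/integrableP; split => //.
have mp := measurable_funepos mf; have mn := measurable_funeneg mf.
rewrite -[fun x => `|f x|%E]/(abse \o f) fune_abse ge0_integralD//.
have p0 : (0 <= \int[mu]_x f^\+ x)%E by exact: integral_ge0.
have n0 : (0 <= \int[mu]_x f^\- x)%E by exact: integral_ge0.
move: p0 n0 fin.
by case: (\int[mu]_x f^\+ x)%E => [p| |]; case: (\int[mu]_x f^\- x)%E => [n| |]//= _ _ _; rewrite ltry.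
Qed.

Section transfer.
Context {d : measure_display} {T : measurableType d} {R : realType}.
Context {P : probability T R} (xi : R -> {RV P >-> R}).

Lemma tailF_prob (t x : R) : tailF (law xi t) x = prob P [set w | x < xi t w].
Proof.
rewrite /tailF /prob /=; congr (fine (P _)); apply/seteqP; split => w /=; by rewrite in_itv/= andbT.
Qed.

Lemma law_integrable (t m : R) : ('E_P[xi t] = m%:E)%E ->
  (law xi t).-integrable setT (EFin : R -> \bar R) /\ (\int[law xi t]_u u%:E = m%:E)%E.
Proof.
rewrite expectation_def => Em.
have mX : measurable_fun setT (EFin \o xi t) by apply/measurable_EFinP.
have iX : P.-integrable setT (EFin \o xi t).
  by apply: fin_integral_integrable => //; rewrite -/(EFin \o xi t) Em.
split; last by rewrite -Em; exact: (@integral_distribution _ _ _ _ _ P (xi t) (EFin : R -> \bar R)).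
apply/integrableP; split; first by apply/measurable_EFinP; exact: measurable_id.
rewrite (@ge0_integral_distribution _ _ _ _ _ P (xi t) (fun u : R => `|u%:E|%E))//.
  by case/integrableP : iX.
by apply: measurableT_comp => //; apply/measurable_EFinP; exact: measurable_id.
Qed.

Lemma expectation_on_gint (lambda b t : R) (f : R -> R) (A : set T) :
  (forall w, f (xi t w) * \1_A w = gexp lambda b (xi t w)) ->
  expectation_on P (fun w => f (xi t w)) A = gint lambda b (law xi t) setT 0.
Proof.
move=> fA; rewrite /expectation_on /gint /Rintegral unlock; congr fine.
rewrite (@ge0_integral_distribution _ _ _ _ _ P (xi t) (fun u : R => (gexp lambda b (u - 0))%:E))//.
- by apply: eq_integral => w _; rewrite fA/= subr0.
- by apply/measurable_EFinP; exact: measurable_gexp_shift.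
- by move=> y; rewrite lee_fin gexp_ge0.
Qed.

End transfer.

Theorem proposition3p10 (R : realType) (d : measure_display)
  (T : measurableType d) (P : probability T R) (xi : R -> {RV P >-> R})
  (a sigma : R) (nu : {measure set R -> \bar R})
  (alpha : R) (l : R -> R)
  (xi_levy : levy_process xi)
  (sigma_ge0 : 0 <= sigma)
  (nu_levy : levy_measure nu)
  (nu_int : (\int[nu]_u (Num.min `|u| (u ^+ 2))%:E < +oo)%E)
  (xi_exponent : has_char_exponent (xi 1) (char_exponent a sigma nu))
  (a_mean : ('E_P[xi 1%R] = (- a)%:E)%E)
  (a_gt0 : 0 < a)
  (alpha_gt1 : 1 < alpha)
  (l_slow : slowly_varying l)
  (tail : asymp_equiv (fun x => prob P [set w | x < xi 1 w])
                      (fun x => x `^ (- alpha) * l x))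
  (local_tail : forall delta : R, 0 < delta ->
     exists2 o1 : R -> R, o1 x @[x --> +oo] --> (0 : R) &
       \forall x \near +oo,
         prob P [set w | x < xi 1 w <= x + delta] =
         alpha / x * prob P [set w | x < xi 1 w] * (delta + o1 x)) :
  forall lambda : R, 0 < lambda ->
    asymp_equiv
      (fun t => expectation_on P (fun w => expR (- lambda * xi t w))
                               [set w | 0 <= xi t w])
      (fun t => alpha / (a * lambda) * prob P [set w | a * t < xi 1 w]) /\
    asymp_equiv
      (fun t => expectation_on P (fun w => expR (lambda * xi t w))
                               [set w | xi t w <= 0])
      (fun t => alpha / (a * lambda) * prob P [set w | a * t < xi 1 w]).
Proof.
have [xi_int xi_mean] := law_integrable xi 1 (- a) a_mean.
pose F := tailF (law xi 1).
have FE : (fun x => prob P [set w | x < xi 1 w]) = F.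
  by apply/funext => x; rewrite /F tailF_prob.
have FEx x : prob P [set w | x < xi 1 w] = F x by rewrite -FE.
rewrite FE in tail.
have alpha_gt0 : 0 < alpha by exact: lt_trans alpha_gt1.
have F_ni : forall x y, x <= y -> F y <= F x by exact: tailF_ni.
have F_gt0 := rv_gt0 F l alpha (tailF_ge0 _) F_ni tail.
have F_scale := rv_scale F l alpha (tailF_ge0 _) F_ni l_slow tail.
have F_loc e : 0 < e -> (F y - F (y + e)) / locd F alpha y @[y --> +oo] --> e.
  move=> e0; have [r r0 H] := local_tail e e0.
  have : e + r x @[x --> +oo] --> e + 0 by apply: cvgD => //; exact: cvg_cst.
  rewrite addr0; apply: cvg_trans; apply: near_eq_cvg; near=> x.
  have x0 : 0 < x by near: x; exact: near_pinfty_gt.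
  rewrite /F -tailF_itv ?lerDl ?ltW//.
  have -> : fine (law xi 1 `]x, x + e]%classic) = prob P [set w | x < xi 1 w <= x + e].
    by rewrite /prob /=; congr (fine (P _)); apply/seteqP; split => w /=; rewrite in_itv.
  have -> : prob P [set w | x < xi 1 w <= x + e] = locd F alpha x * (e + r x).
    by rewrite /locd -FEx; near: x.
  by rewrite mulrC mulKf// gt_eqF// locd_gt0.
(* An exponent strictly between 1 and [alpha]: below [alpha] for the Potter bound, above 1 for
   Chernoff's bound and for [t * F (k * t)] to vanish. *)
pose beta := (1 + alpha) / 2.
have beta_gt1 : 1 < beta by rewrite /beta; lra.
have beta_lt : beta < alpha by rewrite /beta; lra.
have F_up := rv_potter_upper F l alpha (tailF_ge0 _) F_ni l_slow tail _ beta_lt.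
have alpha_lt : alpha < alpha + 1 by rewrite ltrDl.
have F_low := rv_potter_lower F l alpha (tailF_ge0 _) F_ni l_slow tail _ alpha_lt.
move=> lambda lambda_gt0.
have main b : b * b = 1 -> gint lambda b (law xi t) setT 0 /
    (alpha / (a * lambda) * F (a * t)) @[t --> +oo] --> (1 : R).
  (* [t * locd F alpha (a * t)] equals [alpha / a * F (a * t)]: the number of possible times for the
     jump cancels the [t] in the denominator of the local rate. *)
  move=> bb; have : lambda * (gint lambda b (law xi t) setT 0 / (t * locd F alpha (a * t)))
      @[t --> +oo] --> lambda * lambda^-1.
    apply: cvgMl_tmp; exact: (big_jump_cvg xi_levy a alpha beta lambda b xi_int xi_mean
      a_gt0 alpha_gt1 beta_gt1 F_gt0 F_scale F_loc F_up F_low lambda_gt0 bb).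
  rewrite mulfV ?gt_eqF//; apply: cvg_trans.
  apply: near_eq_cvg; near=> t; have t0 : 0 < t by near: t; exact: near_pinfty_gt.
  have := F_gt0 (a * t); rewrite /locd => Fat.
  by rewrite -/F; field; rewrite !gt_eqF.
rewrite /asymp_equiv; split.
- have := main 1 (mulr1 1); apply: cvg_trans; apply: near_eq_cvg; near=> t.
  rewrite FEx (expectation_on_gint xi lambda 1 t (fun x => expR (- lambda * x)))// => w.
  by rewrite /gexp !indicE mul1r mulNr; congr (_ * (nat_of_bool _)%:R); apply/idP/idP; rewrite !inE/= mul1r.
- have b1 : -1 * -1 = 1 :> R by rewrite mulrNN mulr1.
  have := main (-1) b1; apply: cvg_trans; apply: near_eq_cvg; near=> t.
  rewrite FEx (expectation_on_gint xi lambda (-1) t (fun x => expR (lambda * x)))// => w.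
  by rewrite /gexp !indicE mulN1r mulrN opprK; congr (_ * (nat_of_bool _)%:R); apply/idP/idP;
    rewrite !inE/= mulN1r oppr_ge0.
Unshelve. all: by end_near. Qed.
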